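(* Fix any parameters $L_1>L_0>0$, $M>0$, $1\le\beta\le 2$, and $\sigma^2>0$. Then there exist constants $C,C',C''>0$, depending only on these parameters and not on $n$, such that for any $n\ge C$ there exists some $\mu\in\mathbb{R}^n$ satisfying (i) $|\mu_j-\mu_i|\le L_1\cdot\frac{j-i}{n}$ for all $1\le i\le j\le n$; (ii) $\mu_j-\mu_i\ge L_0\cdot\frac{j-i}{n}$ for all $1\le i\le j\le n$; (iii) $\left|\mu_j-\left(\frac{k-j}{k-i}\cdot\mu_i+\frac{j-i}{k-i}\cdot\mu_k\right)\right|\le\frac{M}{4}\cdot\left(\frac{k-i}{n}\right)^{\beta}$ for all $1\le i\le j\le k\le n$ with $i<k$; and such that, for $Y\sim\mathcal{N}(\mu,\sigma^2\mathbf{I}_n)$ and $\widehat{\mu}=\mathrm{iso}(Y)$, the bias satisfies $$\big|\mathbb{E}[\widehat{\mu}_i]-\mu_i\big|\ge C'n^{-\beta/3}(\log n)^{-5\beta/3}$$ for at least $C''n$ many indices $i\in\{1,\dots,n\}$.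
   Context: For $y\in\mathbb{R}^n$, the isotonic regression is $$\mathrm{iso}(y)=\arg\min_{x\in\mathbb{R}^n}\left\{\|y-x\|_2^2 : x_1\le\dots\le x_n\right\},$$ the (unique) Euclidean projection onto the cone of nondecreasing vectors. $\mathbf{I}_n$ is the $n\times n$ identity matrix. *)

(* Defs.v *)
From HB Require Import structures.
From mathcomp Require Import all_boot all_order all_algebra.
From mathcomp Require Import all_classical all_reals all_analysis.
From mathcomp Require Import ring lra.

Set Implicit Arguments.
Unset Strict Implicit.
Unset Printing Implicit Defensive.

Import Order.TTheory GRing.Theory Num.Theory.
Import numFieldNormedType.Exports.

Local Open Scope classical_set_scope.
Local Open Scope ring_scope.

Section isotonic_regression.
Context {R : realType} {n : nat}.
Implicit Types x y : 'rV[R]_n.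

(* The library norm on ['rV[R]_n] is the sup norm, so the squared Euclidean
   norm is written out. *)
Definition sqnorm2 x : R := \sum_(i < n) x 0 i ^+ 2.

Definition nondecreasing_vec : set 'rV[R]_n :=
  [set x | forall i j : 'I_n, (i <= j)%N -> x 0 i <= x 0 j].

Definition iso_argmin y : set 'rV[R]_n :=
  [set x | nondecreasing_vec x /\
     forall z, nondecreasing_vec z -> sqnorm2 (y - x) <= sqnorm2 (y - z)].

(* The default value 0 of [xget] is never used: see [iso_argmin_nonempty],
   [iso_argmin_unique] and [isoP]. *)
Definition iso y : 'rV[R]_n := xget 0 (iso_argmin y).

Lemma iso_argmin_unique y x x' : iso_argmin y x -> iso_argmin y x' -> x = x'.
Proof.
move=> [mx hx] [mx' hx'].
pose z : 'rV[R]_n := 2^-1 *: (x + x').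
have mz : nondecreasing_vec z.
  move=> i j ij; rewrite !mxE ler_pM2l ?invr_gt0 ?ltr0n //.
  by apply: lerD; [exact: mx | exact: mx'].
have h1 := hx _ mz; have h2 := hx' _ mz.
have e : sqnorm2 (x - x') =
    2 * sqnorm2 (y - x) + 2 * sqnorm2 (y - x') - 4 * sqnorm2 (y - z).
  rewrite /sqnorm2 !big_distrr /= -big_split /= -sumrB.
  by apply: eq_bigr => i _; rewrite !mxE; field.
have le0 : sqnorm2 (x - x') <= 0 by rewrite e; lra.
have s0 : sqnorm2 (x - x') = 0.
  by apply/eqP; rewrite eq_le le0 sumr_ge0 // => i _; exact: sqr_ge0.
apply/rowP => i; apply/eqP; rewrite -subr_eq0 -sqrf_eq0; apply/eqP.
have := psumr_eq0P (fun (i : 'I_n) _ => sqr_ge0 ((x - x') 0 i)) s0.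
by move=> /(_ i isT); rewrite !mxE.
Qed.

Lemma iso_argmin_nonempty y : iso_argmin y !=set0.
Proof.
have csq : continuous (fun x : 'rV[R]_n => sqnorm2 (y - x)).
  apply: (@continuous_big R 'I_n +%R 0 xpredT _ 'rV[R]_n (index_enum _)
    (fun i (x : 'rV[R]_n) => (y - x) 0 i ^+ 2)) => [|i _ x].
    by move=> p; apply: cvgD; [exact: cvg_fst | exact: cvg_snd].
  have c : (fun z : 'rV[R]_n => y 0 i - z 0 i) @ x --> y 0 i - x 0 i.
    exact: (cvgB (cvg_cst _) (@coord_continuous R 1 n 0 i x)).
  have -> : (fun z : 'rV[R]_n => (y - z) 0 i ^+ 2) =
      (fun z => (y 0 i - z 0 i) * (y 0 i - z 0 i)).
    by apply/funext => z; rewrite !mxE expr2.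
  by rewrite /continuous_at; exact: (cvgM c c).
pose K := nondecreasing_vec `&`
  [set x : 'rV[R]_n | sqnorm2 (y - x) <= sqnorm2 (y - 0)].
have K0 : K 0 by split => [i j _|] /=; rewrite ?mxE.
have clM : closed nondecreasing_vec.
  have -> : nondecreasing_vec = \bigcap_(p in [set p : 'I_n * 'I_n | (p.1 <= p.2)%N])
      ((fun x : 'rV[R]_n => x 0 p.2 - x 0 p.1) @^-1` [set t | 0 <= t]).
    apply/seteqP; split => x h; first by move=> [i j] /= ij; rewrite subr_ge0 h.
    by move=> i j ij; rewrite -subr_ge0; exact: (h (i, j)).
  apply: closed_bigI => -[i j] _; apply: closed_comp; last exact: closed_ge.
  move=> x _; exact: (cvgB (@coord_continuous R 1 n 0 j x)
    (@coord_continuous R 1 n 0 i x)).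
have clK : closed K.
  apply: closedI => //.
  apply: (@closed_comp _ _ (fun x => sqnorm2 (y - x)) [set t | t <= _]).
    by move=> x _; exact: csq.
  exact: closed_le.
have bK : bounded_set K.
  pose B := Num.sqrt (sqnorm2 (y - 0)).
  exists (`|y| + B); split; first exact: num_real.
  move=> r rB x [_ /= xK]; apply: le_trans (ltW rB).
  have r0 : 0 <= `|y| + B by rewrite addr_ge0 // sqrtr_ge0.
  suff xy : `|y - x| <= B.
    by rewrite -[x in `|x|](subKr y) (le_trans (ler_normB _ _)) // lerD2l.
  change (mx_norm (y - x) <= B).
  have [n0|/mx_norm_neq0[[i j] /= e]] := eqVneq (mx_norm (y - x)) 0.
    by rewrite n0 sqrtr_ge0.
  rewrite e ord1 -sqrtr_sqr ler_sqrt; last first.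
    by apply: sumr_ge0 => k _; exact: sqr_ge0.
  apply: le_trans xK; rewrite /sqnorm2 (bigD1 j) //= lerDl.
  by apply: sumr_ge0 => k _; exact: sqr_ge0.
have cw : {within K, continuous (fun x => sqnorm2 (y - x))}.
  exact: continuous_subspaceT.
have [x] := EVT_min_rV (ex_intro _ 0 K0) (bounded_closed_compact bK clK) cw.
rewrite inE => -[mx xK] xmin.
exists x; split=> // z mz.
have [zK|/ltW zK] := leP (sqnorm2 (y - z)) (sqnorm2 (y - 0)).
  by apply: xmin; rewrite inE.
exact: le_trans zK.
Qed.

Lemma isoP y : iso_argmin y (iso y).
Proof. by have [x hx] := iso_argmin_nonempty y; exact: xgetI hx. Qed.

End isotonic_regression.

Section normal_vector.
Context {d : measure_display} {T : measurableType d} {R : realType} {n : nat}.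

Definition mutually_independent (P : probability T R)
    (Y : 'I_n -> {RV P >-> R}) : Prop :=
  forall (J : {set 'I_n}) (A : 'I_n -> set R),
    (forall i, measurable (A i)) ->
    P (\bigcap_(i in [set` J]) (Y i @^-1` A i)) =
    (\prod_(i in J) P (Y i @^-1` A i))%E.

(* Y ~ N(mu, v I_n).  A Gaussian vector with diagonal covariance is a vector of
   independent Gaussian coordinates; [normal_prob] takes the standard
   deviation as its second parameter. *)
Definition isotropic_normal (P : probability T R)
    (Y : 'I_n -> {RV P >-> R}) (mu : 'rV[R]_n) (v : R) : Prop :=
  mutually_independent Y /\
  forall (i : 'I_n) (A : set R), measurable A ->
    distribution P (Y i) A = normal_prob (mu 0 i) (Num.sqrt v) A.

End normal_vector.

(* Main.v *)
(* Let mu0 be the line of slope (L0 + L1) / 2 and let v be an oscillation of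
   amplitude V ~ (p / n)^beta and half period p ~ n^(2/3) (log n)^(-5/3).  Both mu0
   and mu0 + v satisfy the shape constraints.  Let Y ~ N(mu0, sigma2).  If the block
   of iso(Y) containing i extends over many periods on both sides of i, then replacing
   Y by Y + v moves the value of iso at i by at most V / 4, since v averages out
   over such blocks; in all cases it moves by at most V.  So at an index with
   |v_i| >= 3V/4 the biases of the two signals cannot both be small unless blocks
   are short near i with probability at least 1/4.

   Blocks end at vertices of the convex minorant of the partial sums of Y.  For
   exchangeable increments a window of length m has at most 1 + log m vertices in
   expectation (Sparre Andersen): a face of length l occurs at a given place when the
   partial sums stay above its chord, which by rotation has probability at most 1/l,
   and the remaining increments, glued together, have their first minimum at the
   place where the face was removed.  On windows of length m ~ p log n the slope
   of mu0 is so small that its likelihood ratio with respect to a constant signal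
   is at most e up to an event of probability O(1/n), so the vertex bound
   survives.  Hence short blocks are rare, one of the two signals is biased at a
   positive fraction of the indices, and it is the one to choose. *)

Require Import Defs.
From HB Require Import structures.
From mathcomp Require Import all_boot all_order all_algebra.
From mathcomp Require Import all_classical all_reals all_analysis.
From mathcomp Require Import measurable_realfun.
From mathcomp Require Import ring lra zify.

Set Implicit Arguments.
Unset Strict Implicit.
Unset Printing Implicit Defensive.

Import Order.TTheory GRing.Theory Num.Theory.
Import numFieldNormedType.Exports.

Local Open Scope classical_set_scope.
Local Open Scope ring_scope.

(** * Blocks of the isotonic regression *)

Section vertices.
Context {R : realType}.
Implicit Types u : nat -> R.

(* Vacuously true at k = lo and at k = hi. *)
Definition vertex u (lo hi k : nat) : Prop :=
  forall a b : nat, (lo <= a < k)%N -> (k < b <= hi)%N ->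
  (\sum_(a <= t < k) u t) * (b - k)%:R < (\sum_(k <= t < b) u t) * (k - a)%:R.

Lemma vertexS u lo hi lo' hi' k : (lo <= lo')%N -> (hi' <= hi)%N ->
  vertex u lo hi k -> vertex u lo' hi' k.
Proof.
move=> ll hh vk a b /andP[la ak] /andP[kb bh]; apply: vk.
  by rewrite (leq_trans ll).
by rewrite kb (leq_trans bh).
Qed.

End vertices.

Section isotonic_blocks.
Context {R : realType} {n : nat}.
Implicit Types x y z v : 'rV[R]_n.

(** Indexing by [nat], with value 0 beyond [n], lets sums over intervals be split and shifted
    freely. *)
Definition coordn x (t : nat) : R := oapp (x 0) 0 (insub t).

Lemma coordnE x (i : 'I_n) : coordn x i = x 0 i.
Proof. by rewrite /coordn valK. Qed.

Lemma coordn_lt x t (h : (t < n)%N) : coordn x t = x 0 (Ordinal h).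
Proof. exact: (coordnE x (Ordinal h)). Qed.

Lemma coordn_ge x t : (n <= t)%N -> coordn x t = 0.
Proof. by move=> nt; rewrite /coordn insubN // -leqNgt. Qed.

Lemma coordnD x y t : coordn (x + y) t = coordn x t + coordn y t.
Proof. by rewrite /coordn; case: insubP => [i _ _|_] /=; rewrite ?mxE ?addr0. Qed.

Lemma nondecreasing_coordn x : nondecreasing_vec x ->
  forall s t, (s <= t)%N -> (t < n)%N -> coordn x s <= coordn x t.
Proof.
move=> mx s t st tn; have sn := leq_ltn_trans st tn.
by rewrite (coordn_lt x sn) (coordn_lt x tn); apply: mx.
Qed.

Definition step_vec (k : nat) : 'rV[R]_n := \row_i (k <= i)%N%:R.

(** First-order optimality of the projection against raising or lowering a tail by [d]; the error
    [d ^+ 2 * n] disappears for small [d]. *)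
Lemma iso_perturb y (d : R) k :
  nondecreasing_vec (iso y + d *: step_vec k) ->
  2 * d * (\sum_(i < n | (k <= i)%N) (y 0 i - iso y 0 i)) <= d ^+ 2 * n%:R.
Proof.
move=> mz; have [_ /(_ _ mz)] := isoP y.
set x := iso y.
suff e : sqnorm2 (y - (x + d *: step_vec k)) =
    sqnorm2 (y - x) - 2 * d * (\sum_(i < n | (k <= i)%N) (y 0 i - x 0 i))
    + d ^+ 2 * \sum_(i < n) (k <= i)%N%:R.
  rewrite e => h.
  have : d ^+ 2 * \sum_(i < n) ((k <= i)%N%:R : R) <= d ^+ 2 * n%:R.
    rewrite ler_wpM2l ?sqr_ge0 //.
    apply: (@le_trans _ _ (\sum_(i < n) 1)); first by apply: ler_sum => i _; case: leqP.
    by rewrite sumr_const card_ord.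
  lra.
rewrite [X in _ - 2 * d * X]big_mkcond /= /sqnorm2 !big_distrr /= -sumrB -big_split /=.
by apply: eq_bigr => i _; rewrite !mxE; case: leqP => _ /=; ring.
Qed.

Definition jump x k := (0 < k < n)%N && (coordn x k.-1 < coordn x k).

Lemma step_up_ok x (d : R) k : 0 <= d -> nondecreasing_vec x ->
  nondecreasing_vec (x + d *: step_vec k).
Proof.
move=> d0 mx i j ij; rewrite !mxE lerD ?mx // ler_wpM2l // ler_nat.
by case: (leqP k i) => // ki; rewrite (leq_trans ki ij).
Qed.

Lemma tail_sum_le0 y k : \sum_(i < n | (k <= i)%N) (y 0 i - iso y 0 i) <= 0.
Proof.
set D := \sum_(_ < n | _) _; rewrite leNgt; apply/negP => D0.
(* Small enough that the quadratic error stays below the linear gain: [d * n = D - d < 2 * D]. *)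
pose d := D / (n%:R + 1).
have n1 : 0 < n%:R + 1 :> R by rewrite ltr_wpDl.
have d0 : 0 < d by rewrite divr_gt0.
have [mx _] := isoP y.
have := @iso_perturb y d k (step_up_ok k (ltW d0) mx); rewrite -/D.
rewrite expr2 -mulrA mulrCA -[X in _ <= X]mulrA ler_pM2l //.
have -> : d * n%:R = D - d by rewrite /d; field; rewrite gt_eqF.
lra.
Qed.

(** At a jump the tail can be lowered by up to the jump height without losing monotonicity; at
    [k = 0] the whole vector can be lowered. *)
Lemma tail_sum_ge0 y k : (k = 0)%N \/ jump (iso y) k ->
  0 <= \sum_(i < n | (k <= i)%N) (y 0 i - iso y 0 i).
Proof.
move=> hk; set D := \sum_(_ < n | _) _; rewrite leNgt; apply/negP => D0.
have [mx _] := isoP y.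
have [g g0 hg] : exists2 g : R, 0 < g & forall i j : 'I_n, (i < k)%N -> (k <= j)%N ->
    g <= iso y 0 j - iso y 0 i.
  case: hk => [->|/andP[/andP[k0 kn] lt]]; first by exists 1.
  exists (coordn (iso y) k - coordn (iso y) k.-1) => [|i j ik kj]; first by rewrite subr_gt0.
  rewrite -!coordnE lerB // nondecreasing_coordn //.
    by rewrite -ltnS prednK.
  by rewrite (leq_ltn_trans _ kn) // leq_pred.
pose d := Num.min g (- D / (n%:R + 1)).
have n1 : 0 < n%:R + 1 :> R by rewrite ltr_wpDl.
have d0 : 0 < d by rewrite lt_min g0 divr_gt0 // oppr_gt0.
have mz : nondecreasing_vec (iso y + (- d) *: step_vec k).
  move=> i j ij; rewrite !mxE.
  case: (leqP k i) => ki.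
    by rewrite (leq_trans ki ij) lerD2r; exact: mx.
  case: (leqP k j) => kj /=; last by rewrite lerD2r; exact: mx.
  have dg : d <= g by rewrite ge_min lexx.
  by have := hg _ _ ki kj; move: dg; lra.
have := iso_perturb mz; rewrite -/D sqrrN.
have dD : d <= - D / (n%:R + 1) by rewrite ge_min lexx orbT.
have : d * n%:R <= - D - d.
  have : d * (n%:R + 1) <= - D by rewrite -ler_pdivlMr.
  lra.
move=> h1 h2; have h3 := ler_wpM2l (ltW d0) h1.
have h4 : 0 < d * (- D + d) by rewrite mulr_gt0 // addr_gt0 // oppr_gt0.
suff : d * (- D + d) <= 0 by rewrite leNgt h4.
by move: h2 h3; rewrite expr2; lra.
Qed.

(** Gap between the partial sums of [y] and their greatest convex minorant, whose increments are
    [iso y]. It is nonnegative and vanishes at block edges. *)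
Definition cumdiff y k := \sum_(0 <= t < k) (coordn y t - coordn (iso y) t).

Lemma cumdiff_tail y k : (k <= n)%N ->
  cumdiff y k + \sum_(i < n | (k <= i)%N) (y 0 i - iso y 0 i) = cumdiff y n.
Proof.
move=> kn; rewrite /cumdiff [RHS](@big_cat_nat _ _ _ k) //=; congr (_ + _).
rewrite [RHS](big_nat_widenl _ 0) // big_mkord.
by apply: eq_big => [i|i _]; rewrite ?coordnE.
Qed.

Lemma cumdiff_n y : cumdiff y n = 0.
Proof.
rewrite -(@cumdiff_tail y 0) // /cumdiff big_geq // add0r.
by apply/eqP; rewrite eq_le tail_sum_le0 tail_sum_ge0 //; left.
Qed.

Lemma cumdiff_ge0 y k : (k <= n)%N -> 0 <= cumdiff y k.
Proof.
by move=> kn; have := cumdiff_tail y kn; rewrite cumdiff_n; have := tail_sum_le0 y k; lra.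
Qed.

Definition block_edge x k := [\/ (k = 0)%N, k = n | jump x k].

Lemma cumdiff_edge y k : block_edge (iso y) k -> cumdiff y k = 0.
Proof.
case=> [->|->|jk]; [by rewrite /cumdiff big_geq | exact: cumdiff_n|].
have kn : (k <= n)%N by case/andP: jk => /andP[_ /ltnW].
have := cumdiff_tail y kn; rewrite cumdiff_n.
have := @tail_sum_ge0 y k (or_intror jk); have := tail_sum_le0 y k.
by lra.
Qed.

Lemma sum_iso y a b : (a <= b)%N ->
  \sum_(a <= t < b) coordn y t =
  \sum_(a <= t < b) coordn (iso y) t + (cumdiff y b - cumdiff y a).
Proof.
move=> ab; rewrite /cumdiff (@big_cat_nat _ _ _ a 0 b) //= addrC addrK.
by rewrite -big_split /=; apply: eq_bigr => t _; ring.
Qed.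

(** The gap vanishes at [b] and is nonnegative at [a], so over this interval [y] sums to at most
    what [iso y] does. *)
Lemma iso_avg_le y (c : R) a b : (a <= b <= n)%N -> block_edge (iso y) b ->
  (forall t, (a <= t < b)%N -> coordn (iso y) t <= c) ->
  \sum_(a <= t < b) coordn y t <= (b - a)%:R * c.
Proof.
move=> /andP[ab bn] eb hc; rewrite sum_iso // (cumdiff_edge eb) sub0r.
rewrite lerBlDr ler_wpDr ?cumdiff_ge0 ?(leq_trans ab) //.
apply: (@le_trans _ _ (\sum_(a <= t < b) c)).
  by rewrite !big_nat; apply: ler_sum.
by rewrite sumr_const_nat mulr_natl.
Qed.

Lemma iso_avg_ge y (c : R) a b : (a <= b <= n)%N -> block_edge (iso y) a ->
  (forall t, (a <= t < b)%N -> c <= coordn (iso y) t) ->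
  (b - a)%:R * c <= \sum_(a <= t < b) coordn y t.
Proof.
move=> /andP[ab bn] ea hc; rewrite sum_iso // (cumdiff_edge ea) subr0.
rewrite ler_wpDr ?cumdiff_ge0 //.
apply: (@le_trans _ _ (\sum_(a <= t < b) c)); last first.
  by rewrite !big_nat; apply: ler_sum.
by rewrite sumr_const_nat mulr_natl.
Qed.

(** Averages of [y] ending at [k] are at most [iso y] at [k.-1], averages starting at [k] are at
    least [iso y] at [k], and the jump separates the two. *)
Lemma jump_vertex y k : jump (iso y) k -> vertex (coordn y) 0 n k.
Proof.
move=> jk a b /andP[_ ak] /andP[kb bn].
have [mx _] := isoP y; have ek : block_edge (iso y) k by constructor 3.
have /andP[/andP[k0 kn] lt] := jk.
have h1 : \sum_(a <= t < k) coordn y t <= (k - a)%:R * coordn (iso y) k.-1.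
  apply: iso_avg_le => // [|t /andP[_ tk]]; first by rewrite (ltnW ak) ltnW.
  apply: nondecreasing_coordn => //; last exact: leq_ltn_trans (leq_pred k) kn.
  by rewrite -ltnS prednK.
have h2 : (b - k)%:R * coordn (iso y) k <= \sum_(k <= t < b) coordn y t.
  apply: iso_avg_ge => // [|t /andP[kt tb]]; first by rewrite (ltnW kb).
  by apply: nondecreasing_coordn => //; exact: leq_trans tb bn.
have ka : 0 < (k - a)%:R :> R by rewrite ltr0n subn_gt0.
have bk : 0 < (b - k)%:R :> R by rewrite ltr0n subn_gt0.
apply: (le_lt_trans (ler_wpM2r (ltW bk) h1)).
apply: lt_le_trans (ler_wpM2r (ltW ka) h2).
rewrite [ltRHS]mulrAC [ltLHS]mulrC mulrA ltr_pM2l //; exact: mulr_gt0.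
Qed.

(* On its constancy block, iso y is the max-min of interval averages of y, and
   the interior block ends are vertices of the convex minorant of partial sums. *)
Lemma iso_block y (i : 'I_n) : exists j k : nat,
  [/\ (j <= i)%N, (i < k <= n)%N,
      (j = 0)%N \/ vertex (coordn y) 0 n j, k = n \/ vertex (coordn y) 0 n k &
      (forall a, (a <= i)%N -> \sum_(a <= t < k) coordn y t <= (k - a)%:R * iso y 0 i) /\
      (forall b, (i < b <= n)%N -> (b - j)%:R * iso y 0 i <= \sum_(j <= t < b) coordn y t)].
Proof.
have [mx _] := isoP y.
(* The block of [i] is delimited by the first edge after [i] and, below, by the last edge not after
   [i]. *)
pose Pk k := (i < k <= n)%N && ((k == n) || jump (iso y) k).
have exk : exists k, Pk k by exists n; rewrite /Pk ltn_ord leqnn eqxx.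
case: (ex_minnP exk) => k /andP[/andP[ik kn] ek] mink.
pose Pj j := (j <= i)%N && ((j == 0)%N || jump (iso y) j).
have exj : exists j, Pj j by exists 0%N.
have bj j : Pj j -> (j <= i)%N by case/andP.
case: (ex_maxnP exj bj) => j /andP[ji ej] maxj.
exists j, k; split; rewrite ?ik //.
- by case/orP: ej => [/eqP|/jump_vertex]; [left|right].
- by case/orP: ek => [/eqP|/jump_vertex]; [left|right].
split=> [a ai|b /andP[ib bn]].
- apply: iso_avg_le.
  + by rewrite (leq_trans ai) // ltnW.
  + by case/orP: ek => [/eqP|]; [constructor 2|constructor 3].
  move=> t /andP[_ tk].
  have [ti|it] := leqP t i; first by rewrite -coordnE nondecreasing_coordn.
  (* A rise between [i] and [t] would be a jump before [k], against the minimality of [k]. *)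
  elim: t it tk => // t IH; rewrite ltnS leq_eqVlt => /orP[/eqP it|it] tk.
    rewrite leNgt; apply/negP => h.
    have : Pk t.+1 by rewrite /Pk -it ltnS leqnn /= {1}it (ltnW (leq_trans tk kn)) /jump /=
      it (leq_trans tk kn) -it coordnE it h orbT.
    by move/mink; rewrite leqNgt tk.
  apply: le_trans (IH it (ltnW tk)); rewrite leNgt; apply/negP => h.
  have : Pk t.+1 by rewrite /Pk (ltnW (leq_trans tk kn)) /jump /= (leq_trans tk kn) h orbT ltnS ltnW.
  by move/mink; rewrite leqNgt tk.
- apply: iso_avg_ge.
  + by rewrite (leq_trans ji) // ltnW.
  + by case/orP: ej => [/eqP|]; [constructor 1|constructor 3].
  move=> t /andP[jt tb].
  have [it|ti] := leqP i t.
    by rewrite -coordnE nondecreasing_coordn // (leq_trans tb).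
  have : coordn (iso y) i <= coordn (iso y) t.
    have [m im] : exists m, (t + m = i)%N by exists (i - t)%N; rewrite subnKC // ltnW.
    elim: m t jt {tb ti} im => [|m IH] t jt im; first by rewrite -im addn0.
    have im' : (t.+1 + m = i)%N by rewrite -im addnS addSn.
    apply: le_trans (IH t.+1 (leqW jt) im') _; rewrite leNgt; apply/negP => h.
    have ti : (t.+1 <= i)%N by rewrite -im' leq_addr.
    have : Pj t.+1 by rewrite /Pj /jump /= ti (leq_ltn_trans ti) // h.
    by move/maxj; rewrite leqNgt ltnS jt.
  by rewrite coordnE.
Qed.

(** The max-min formula: superlevel sets of [iso] become finite combinations of linear inequalities,
    which gives measurability. *)
Lemma iso_geP y (i : 'I_n) (c : R) : c <= iso y 0 i <->
  exists j : 'I_n, (j <= i)%N /\ forall b : 'I_n, (i <= b)%N ->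
    (b.+1 - j)%:R * c <= \sum_(j <= t < b.+1) coordn y t.
Proof.
have [j [k [ji /andP[ik kn] _ _ [U L]]]] := iso_block y i; split=> [cx|].
  exists (Ordinal (leq_ltn_trans ji (ltn_ord i))); split => // b ib.
  by apply: le_trans (L b.+1 _); rewrite ?ler_wpM2l //= ltnS ib ltn_ord.
move=> [j' [ji' h]].
case: k ik kn U => // k ik kn U; have := h (Ordinal kn) ik.
move=> /le_trans/(_ (U _ ji')); rewrite ler_pM2l // ltr0n subn_gt0.
by rewrite ltnS (leq_trans ji').
Qed.

(** Here [j], [k] bound the block for [y] and [j'], [k'] the block for [y + v]. On the crossed
    intervals from [j'] to [k] and from [j] to [k'] the inequalities of [iso_block] for the two
    vectors subtract, leaving only sums of [v]. *)
Lemma iso_shift_sum y v (i : 'I_n) : exists j k j' k' : nat,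
  [/\ (j <= i < k)%N, (j' <= i < k')%N, (k <= n)%N && (k' <= n)%N,
      ((j = 0)%N \/ vertex (coordn y) 0 n j) /\ (k = n \/ vertex (coordn y) 0 n k) &
      (k - j')%:R * (iso (y + v) 0 i - iso y 0 i) <= \sum_(j' <= t < k) coordn v t /\
      \sum_(j <= t < k') coordn v t <= (k' - j)%:R * (iso (y + v) 0 i - iso y 0 i)].
Proof.
have [j [k [ji /andP[ik kn] ej ek [U L]]]] := iso_block y i.
have [j' [k' [ji' /andP[ik' kn'] _ _ [U' L']]]] := iso_block (y + v) i.
exists j, k, j', k'; split; rewrite ?ji ?ji' ?kn ?kn' //.
have sumE a b : \sum_(a <= t < b) coordn v t =
    \sum_(a <= t < b) coordn (y + v) t - \sum_(a <= t < b) coordn y t.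
  by rewrite -sumrB; apply: eq_bigr => t _; rewrite coordnD addrAC subrr add0r.
have := U j' ji'; have := L k'; have := U' j ji; have := L' k.
by rewrite !sumE ik ik' kn kn' => /(_ isT) + + /(_ isT); lra.
Qed.

Lemma iso_shift_bound y v (i : 'I_n) (B : R) :
  (forall t : 'I_n, `|v 0 t| <= B) -> `|iso (y + v) 0 i - iso y 0 i| <= B.
Proof.
move=> hB; have [j [k [j' [k' [/andP[ji ik] /andP[ji' ik'] /andP[kn kn'] _ [h1 h2]]]]]] :=
  iso_shift_sum y v i.
have hv t : (t < n)%N -> - B <= coordn v t <= B.
  by move=> tn; rewrite (coordn_lt v tn) -ler_norml.
have sB a b : (b <= n)%N -> - ((b - a)%:R * B) <= \sum_(a <= t < b) coordn v t <= (b - a)%:R * B.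
  move=> bn; rewrite !mulr_natl -mulNrn -!sumr_const_nat !big_nat.
  by rewrite !ler_sum // => t /andP[_ tb]; have /andP[] := hv t (leq_trans tb bn).
have kj : 0 < (k - j')%:R :> R by rewrite ltr0n subn_gt0 (leq_ltn_trans ji').
have kj' : 0 < (k' - j)%:R :> R by rewrite ltr0n subn_gt0 (leq_ltn_trans ji).
have /andP[_ /(le_trans h1)] := sB j' k kn; rewrite ler_pM2l // => hU.
have /andP[+ _] := sB j k' kn'; move=> /le_trans/(_ h2).
by rewrite -mulrN ler_pM2l // => hL; rewrite ler_norml hU hL.
Qed.

(** Without a vertex within distance [K] of [i], the block of [iso y] reaches at least [K] on both
    sides, so both crossed intervals have length at least [K] while the sums of [v] stay below [B].
    The ends 0 and [n] are far away as well, since the window contains the [K]-neighbourhood of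
    [i]. *)
Lemma iso_shift_bound_away y v (i : 'I_n) (B : R) (K lo hi : nat) :
  (0 < K)%N -> (lo + K <= i)%N -> (i + K <= hi)%N -> (hi <= n)%N ->
  (forall k, (i < k + K)%N -> (k < i + K)%N -> ~ vertex (coordn y) lo hi k) ->
  (forall a b, (a <= b <= n)%N -> `|\sum_(a <= t < b) coordn v t| <= B) ->
  `|iso (y + v) 0 i - iso y 0 i| <= B / K%:R.
Proof.
move=> K0 loi ihi hin nv hB.
have [j [k [j' [k' [/andP[ji ik] /andP[ji' ik'] /andP[kn kn'] [ej ek] [h1 h2]]]]]] :=
  iso_shift_sum y v i.
have iK : (i + K <= k)%N.
  rewrite leqNgt; apply/negP => kiK; case: ek => [kE|vk].
    by move: kiK; rewrite kE ltnNge (leq_trans ihi hin).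
  by apply: (nv k) => //; [rewrite (leq_trans ik) // leq_addr | exact: vertexS vk].
have jK : (j + K <= i)%N.
  rewrite leqNgt; apply/negP => ijK; case: ej => [jE|vj].
    by move: ijK; rewrite jE add0n ltnNge (leq_trans _ loi) // leq_addl.
  apply: (nv j) => //; [|exact: vertexS vj].
  by rewrite (leq_ltn_trans ji) // -[X in (X < _)%N]addn0 ltn_add2l.
have KR : 0 < K%:R :> R by rewrite ltr0n.
have B0 : 0 <= B by apply: le_trans (hB 0%N 0%N _) => //; rewrite big_geq // normr0.
have kjK : (K%:R : R) <= (k - j')%:R.
  by rewrite ler_nat leq_subRL ?(leq_trans _ iK) // ?(leq_trans ji') ?leq_addr // leq_add2r.
have kjK' : (K%:R : R) <= (k' - j)%:R.
  by rewrite ler_nat leq_subRL ?(leq_trans jK) // ?(leq_trans ji) // ltnW.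
have jk : (j' <= k <= n)%N by rewrite kn andbT (leq_trans ji') // ltnW.
have jk' : (j <= k' <= n)%N by rewrite kn' andbT (leq_trans ji) // ltnW.
have := hB _ _ jk; have := hB _ _ jk'; rewrite !ler_norml => /andP[b1 _] /andP[_ b2].
have H1 := le_trans h1 b2; have H2 := le_trans b1 h2.
rewrite -mulNr ler_pdivrMr // ler_pdivlMr //.
set D := _ - _ in H1 H2 *; apply/andP; split.
  have [D0|D0] := leP 0 D; first
    by apply: (@le_trans _ _ 0); rewrite ?oppr_le0 ?mulr_ge0 // ltW.
  by apply: le_trans H2 _; rewrite mulrC ler_nM2l.
have [D0|D0] := leP D 0; first
  by apply: (@le_trans _ _ 0); rewrite ?mulr_le0_ge0 // ltW.
by apply: le_trans H1; rewrite mulrC ler_pM2r.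
Qed.

End isotonic_blocks.

(** * Laws of independent normal coordinates *)

Section density.
Context d (T : measurableType d) (R : realType).
Variables (lam nu : {measure set T -> \bar R}) (h : T -> R).
Hypotheses (mh : measurable_fun setT h) (h0 : forall x, 0 <= h x).
Hypothesis nuE : forall A, measurable A -> nu A = (\int[lam]_(x in A) (h x)%:E)%E.

Import HBNNSimple.
Local Open Scope ereal_scope.

Let integral_density_nnsfun (f : {nnsfun T >-> R}) :
  \int[nu]_x (f x)%:E = \int[lam]_x ((f x)%:E * (h x)%:E).
Proof.
under [LHS]eq_integral do rewrite fimfunE -fsumEFin//.
rewrite [LHS]ge0_integral_fsum//; last 2 first.
  - by move=> r; exact/measurable_EFinP/measurable_funM.
  - by move=> n x _; rewrite nnfun_muleindic_ge0.
under [RHS]eq_integral.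
  move=> x _; rewrite fimfunE -fsumEFin// ge0_mule_fsuml; last first.
    by move=> r; rewrite nnfun_muleindic_ge0.
  over.
rewrite [RHS]ge0_integral_fsum//; last 2 first.
  - move=> r; apply: emeasurable_funM; last exact/measurable_EFinP.
    by exact/measurable_EFinP/measurable_funM.
  - by move=> n x _; rewrite mule_ge0 ?nnfun_muleindic_ge0 ?lee_fin.
apply: eq_fsbigr => r _; rewrite integralZl_indic_nnsfun// integral_indic// setIT nuE//.
have [r0|r0] := leP 0%R r; last first.
  rewrite preimage_nnfun0// integral_set0 mule0 integral0_eq// => x _.
  by rewrite indicE in_set0 mulr0 mul0e.
rewrite -ge0_integralZl//; last 2 first.
  - exact/measurable_EFinP/measurable_funTS.
  - by move=> x _; rewrite lee_fin.
rewrite integral_mkcond; apply: eq_integral => x _.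
by rewrite patchE indicE; case: ifPn => _; rewrite ?mulr1 // mulr0 mul0e.
Qed.

Lemma ge0_integral_density (f : T -> \bar R) :
  measurable_fun setT f -> (forall x, 0 <= f x) ->
  \int[nu]_x f x = \int[lam]_x (f x * (h x)%:E).
Proof.
move=> mf f0.
pose f_ := nnsfun_approx measurableT mf.
transitivity (limn (fun n => \int[nu]_x (f_ n x)%:E)).
  rewrite -monotone_convergence//=.
  - apply: eq_integral => ? /[!inE] xD; apply/esym/cvg_lim => //=.
    exact: cvg_nnsfun_approx.
  - by move=> n; exact/measurable_EFinP/measurable_funTS.
  - by move=> n ? _; rewrite lee_fin.
  - by move=> ? _ ? ? mn; rewrite lee_fin; exact/lefP/nd_nnsfun_approx.
under eq_fun do rewrite integral_density_nnsfun.
rewrite -monotone_convergence//=.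
- apply: eq_integral => x _; apply: cvg_lim => //.
  by apply: cvgeZr => //; exact: cvg_nnsfun_approx.
- move=> n; apply: emeasurable_funM; last exact/measurable_EFinP.
  exact/measurable_EFinP/measurable_funTS.
- by move=> n x _; rewrite mule_ge0 ?lee_fin.
- move=> x _ a b ab; rewrite lee_wpmul2r ?lee_fin//; exact/lefP/nd_nnsfun_approx.
Qed.

End density.

Section normal_facts.
Context {R : realType} (s : R) (s0 : 0 < s).
Local Notation RR := (measurableTypeR R).

(** Logarithm of the density ratio of the normal laws with means [b] and [c] and common standard
    deviation [s]. *)
Definition normal_llr (b c x : R) : R :=
  ((b - c) * (x - c) - (b - c) ^+ 2 / 2) / s ^+ 2.

Lemma normal_llr0 c x : normal_llr c c x = 0.
Proof. by rewrite /normal_llr subrr mul0r expr0n /= mul0r subr0 mul0r. Qed.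

Lemma measurable_normal_llr b c : measurable_fun setT (normal_llr b c : RR -> RR).
Proof.
apply: measurable_funM => //; apply: measurable_funB => //.
by apply: measurable_funM => //; apply: measurable_funB.
Qed.

Lemma integral_normalE (b : R) (f : RR -> \bar R) :
  measurable_fun setT f -> (forall x, 0 <= f x)%E ->
  (\int[normal_prob b s]_x f x =
   \int[lebesgue_measure]_x (f x * (normal_pdf b s x)%:E))%E.
Proof.
apply: ge0_integral_density => //.
  exact: measurable_normal_pdf.
by move=> x; exact: normal_pdf_ge0.
Qed.

Lemma integral_normal_llr (b c : R) (f : RR -> \bar R) :
  measurable_fun setT f -> (forall x, 0 <= f x)%E ->
  (\int[normal_prob b s]_x f x =
   \int[normal_prob c s]_x (f x * (expR (normal_llr b c x))%:E))%E.
Proof.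
move=> mf f0; rewrite (integral_normalE b mf f0) integral_normalE; last 2 first.
- apply: emeasurable_funM => //; apply/measurable_EFinP.
  by apply: measurableT_comp => //; exact: measurable_normal_llr.
- by move=> x; rewrite mule_ge0 // lee_fin expR_ge0.
apply: eq_integral => x _; rewrite -muleA; congr (_ * _)%E; rewrite -EFinM; congr EFin.
rewrite !normal_pdfE ?gt_eqF // /normal_fun mulrCA -expRD; congr (_ * expR _).
by rewrite /normal_llr -(mulr_natr (s ^+ 2)); field; rewrite gt_eqF.
Qed.

Lemma lebesgue_measure_shift (c : R) (A : set R) : measurable A ->
  pushforward lebesgue_measure ((fun x => x + c) : RR -> RR) A = lebesgue_measure A :> \bar R.
Proof.
move=> mA; apply/esym/lebesgue_measure_unique => //=.
  exact: measurable_funD.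
move=> mc _ [[a b]] _ <-.
rewrite /pushforward.
have -> : ((fun x : R => x + c) @^-1` `]a, b]%classic) = `]a - c, b - c]%classic.
  by apply/seteqP; split => x; rewrite /= !in_itv /= ltrBlDr lerBrDr.
rewrite !lebesgue_measure_itv /= !lte_fin ltrD2r; case: ifP => // _.
by rewrite -!EFinB; congr EFin; lra.
Qed.

Lemma normal_prob_shift (b c : R) (A : set R) : measurable A ->
  normal_prob b s ((fun x => x + c) @^-1` A) = normal_prob (b + c) s A.
Proof.
move=> mA; rewrite /normal_prob.
have mc : measurable_fun setT ((fun x => x + c) : RR -> RR) by apply: measurable_funD.
transitivity (\int[pushforward lebesgue_measure ((fun x => x + c)%R : RR -> RR)]_(x in A)
   (normal_pdf (b + c) s x)%:E)%E.
  rewrite ge0_integral_pushforward //; last 2 first.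
  - by apply: measurable_funTS; apply/measurable_EFinP; exact: measurable_normal_pdf.
  - by move=> x _; rewrite lee_fin normal_pdf_ge0.
  have pdf_shift x : normal_pdf b s x = normal_pdf (b + c) s (x + c).
    rewrite !normal_pdfE ?gt_eqF // /normal_fun.
    have -> : x + c - (b + c) = x - b by ring.
    by [].
  by apply: eq_integral => x _ /=; rewrite pdf_shift.
by apply: eq_measure_integral => B mB _; exact: lebesgue_measure_shift.
Qed.

End normal_facts.

(** * Product normal laws on tuples and change of mean *)

Section normal_product_laws.
Context {R : realType} (s : R) (s0 : 0 < s) (n : nat).
Implicit Types (a b c : 'I_n -> R).
Local Notation RR := (measurableTypeR R).
Local Notation V := (n.-tuple RR).

Definition gauss (x : R) : probability RR R := normal_prob x s.

Definition tbox (A : 'I_n -> set RR) : set V := [set z | forall i, A i (tnth z i)].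

Lemma measurable_tbox A : (forall i, measurable (A i)) -> measurable (tbox A).
Proof.
move=> mA; rewrite (_ : tbox A = \big[setI/setT]_(i < n) ((fun z : V => tnth z i) @^-1` A i)).
  apply: bigsetI_measurable => i _.
  by rewrite -[X in measurable X]setTI; apply: measurable_tnth.
rewrite -bigcap_seq /=; apply/seteqP; split => z /= h; last by move=> i; apply: h; rewrite /= mem_index_enum.
by move=> i _; exact: h.
Qed.

Definition normal_law a (P : probability V R) := forall A : 'I_n -> set RR,
  (forall i, measurable (A i)) ->
  P (tbox A) = (\prod_(i < n) gauss (a i) (A i))%E.

(** Boxes are closed under intersection and generate the sigma-algebra of tuples. *)
Lemma normal_law_unique a (P Q : probability V R) :
  normal_law a P -> normal_law a Q -> forall S, measurable S -> P S = Q S.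
Proof.
move=> hP hQ S mS.
pose G : set (set V) := [set B | exists2 A : 'I_n -> set RR, (forall i, measurable (A i)) & B = tbox A].
apply: (measure_unique G (fun=> setT)) => //.
- apply/seteqP; split; last first.
    apply: smallest_sub; first exact: sigma_algebra_measurable.
    by move=> _ [A mA ->]; exact: measurable_tbox.
  apply: smallest_sub => //.
  move=> B; rewrite -bigcup_seq /= => -[i _ [C mC <-]]; rewrite setTI.
  apply: sub_sigma_algebra; exists (fun j => if j == i then C else setT).
    by move=> j; case: ifP.
  apply/seteqP; split => z /=; last by move/(_ i); rewrite /= eqxx.
  by move=> hz j; case: eqVneq => [->|].
- move=> _ _ [A mA ->] [B mB ->]; exists (fun i => A i `&` B i).
    by move=> i; exact: measurableI.
  apply/seteqP; split => z /= h; first by case: h => ? ? i; split.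
  by split=> i; case: (h i).
- move=> i; exists (fun=> setT) => //.
  by apply/seteqP; split.
- by rewrite bigcup_const //; exists 0%N.
- by move=> _ [A mA ->]; exact: (etrans (hP A mA) (esym (hQ A mA))).
- by move=> k; rewrite (le_lt_trans (probability_le1 _ _)) ?ltry.
Qed.

Lemma integral_law_unique a (P Q : probability V R) (f : V -> \bar R) :
  normal_law a P -> normal_law a Q -> (\int[P]_x f x = \int[Q]_x f x)%E.
Proof.
move=> hP hQ; apply: eq_measure_integral => A mA _.
exact: (normal_law_unique hP hQ).
Qed.

Definition tupdate (r : 'I_n) (w : V * RR) : V :=
  [tuple if i == r then w.2 else tnth w.1 i | i < n].

Definition update_at a (r : 'I_n) (x : R) : 'I_n -> R := fun i => if i == r then x else a i.

Lemma measurable_tupdate (r : 'I_n) : measurable_fun setT (tupdate r).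
Proof.
apply/measurable_fun_tnthP => i /=.
rewrite (_ : _ \o _ = fun w : V * RR => if i == r then w.2 else tnth w.1 i).
  case: eqVneq => _; first exact: measurable_snd.
  by apply: (measurableT_comp (measurable_tnth i)); exact: measurable_fst.
by apply/funext => w /=; rewrite tnth_mktuple.
Qed.

HB.instance Definition _ (r : 'I_n) :=
  isMeasurableFun.Build _ _ _ _ (tupdate r) (measurable_tupdate r).

Definition tupdate_law (P : probability V R) (r : 'I_n) (x : R) : probability V R :=
  distribution (P \x gauss x)%E (tupdate r).

(** The old coordinate [r] is integrated out, which corresponds to a box with full side at [r], and
    an independent new one takes its place. *)
Lemma normal_law_tupdate a (P : probability V R) (r : 'I_n) (x : R) : normal_law a P ->
  normal_law (update_at a r x) (tupdate_law P r x).
Proof.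
move=> hP A mA; rewrite /tupdate_law /= /distribution /pushforward.
pose B := fun i => if i == r then setT else A i.
have -> : tupdate r @^-1` tbox A = tbox B `*` A r.
  apply/seteqP; split => -[z y] /=; rewrite /tbox /B /=.
    move=> h; split=> [i|]; last by have := h r; rewrite tnth_mktuple eqxx.
    by have := h i; rewrite tnth_mktuple; case: eqVneq.
  move=> [h1 h2] i; rewrite tnth_mktuple; case: eqVneq => [-> //|ir].
  by have := h1 i; rewrite (negbTE ir).
have mB i : measurable (B i) by rewrite /B; case: ifP.
rewrite product_measure1E //; last exact: measurable_tbox.
rewrite [X in (X * _)%E](hP B) // (bigD1 r) //= [in RHS](bigD1 r) //= /update_at /B eqxx.
rewrite (probability_setT (gauss (a r))) mul1e muleC; congr (_ * _)%E.
by apply: eq_bigr => i /negbTE ->.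
Qed.

(** Tonelli isolates coordinate [r] in a one-dimensional inner integral, so that means can be
    changed one at a time. *)
Lemma ge0_integral_tupdate a (P Q : probability V R) (r : 'I_n) (x : R) (f : V -> \bar R) :
  normal_law a P -> normal_law (update_at a r x) Q ->
  measurable_fun setT f -> (forall z, 0 <= f z)%E ->
  (\int[Q]_z f z = \int[P]_z \int[gauss x]_y f (tupdate r (z, y)))%E.
Proof.
move=> hP hQ mf f0.
rewrite (integral_law_unique _ hQ (normal_law_tupdate r x hP)).
rewrite ge0_integral_pushforward //.
rewrite preimage_setT fubini_tonelli1 //.
  by apply: measurableT_comp => //; exact: measurable_tupdate.
by move=> w; exact: f0.
Qed.

Definition law_llr a c (z : V) : R := \sum_(i < n) normal_llr s (a i) (c i) (tnth z i).

Lemma measurable_law_llr a c : measurable_fun setT (law_llr a c).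
Proof.
apply: measurable_sum => i; apply: measurableT_comp; last exact: measurable_tnth.
exact: measurable_normal_llr.
Qed.

(** Induction on the number [m] of leading coordinates where the means may differ; each step moves
    one density ratio into the integrand. *)
Let ge0_integral_law_llr_prefix m a c (P Q : probability V R) (f : V -> \bar R) :
  (m <= n)%N -> (forall i : 'I_n, (m <= i)%N -> a i = c i) ->
  normal_law a P -> normal_law c Q ->
  measurable_fun setT f -> (forall z, 0 <= f z)%E ->
  (\int[P]_z f z = \int[Q]_z (f z * (expR (law_llr a c z))%:E))%E.
Proof.
move=> + + + hQ; elim: m a P f => [|m IH] a P f mn hac hP mf f0.
  have ac : a = c by apply/funext => i; exact: hac.
  rewrite ac in hP *; rewrite (integral_law_unique f hP hQ).
  apply: eq_integral => z _; rewrite /law_llr big1 ?expR0 ?mule1 // => i _.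
  exact: normal_llr0.
pose r := Ordinal mn; pose c1 := update_at a r (c r).
have h1 : normal_law c1 (tupdate_law P r (c r)) by exact: normal_law_tupdate.
(* [P] and the intermediate law both arise from the intermediate law by resampling coordinate [r],
   so their integrals differ only in the inner one. *)
have h1a : normal_law (update_at c1 r (a r)) P.
  suff -> : update_at c1 r (a r) = a by [].
  by apply/funext => i; rewrite /c1 /update_at; case: eqVneq => [->|].
have h11 : normal_law (update_at c1 r (c r)) (tupdate_law P r (c r)).
  suff -> : update_at c1 r (c r) = c1 by [].
  by apply/funext => i; rewrite /c1 /update_at; case: eqVneq.
rewrite (ge0_integral_tupdate h1 h1a mf f0).
pose g (z : V) := (f z * (expR (normal_llr s (a r) (c r) (tnth z r)))%:E)%E.
have mg : measurable_fun setT g.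
  apply: emeasurable_funM => //; apply/measurable_EFinP.
  apply: measurableT_comp => //; apply: measurableT_comp; last exact: measurable_tnth.
  exact: measurable_normal_llr.
have g0 z : (0 <= g z)%E by rewrite mule_ge0 // lee_fin expR_ge0.
transitivity (\int[tupdate_law P r (c r)]_z g z)%E.
  rewrite (ge0_integral_tupdate h1 h11 mg g0); apply: eq_integral => z _.
  have mfz : measurable_fun setT (fun y : RR => f (tupdate r (z, y))).
    apply: measurableT_comp => //.
    apply: measurableT_comp; first exact: measurable_tupdate.
    exact: measurable_pair1.
  apply: (etrans (integral_normal_llr s0 (a r) (c r) mfz (fun y => f0 _))).
  by apply: eq_integral => y _; rewrite /g tnth_mktuple eqxx.
have hc1 (i : 'I_n) : (m <= i)%N -> c1 i = c i.
  move=> mi; rewrite /c1 /update_at; case: eqVneq => [-> //|ir].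
  by apply: hac; rewrite ltn_neqAle mi andbT; apply: contra ir => /eqP e; apply/eqP/val_inj.
rewrite (IH c1 (tupdate_law P r (c r)) g (ltnW mn) hc1 h1 mg g0).
  apply: eq_integral => z _; rewrite /g -muleA -EFinM -expRD; congr (_ * (expR _)%:E)%E.
  rewrite /law_llr (bigD1 r) //= /c1 /update_at eqxx normal_llr0 add0r.
  rewrite [in RHS](bigD1 r) //=; congr (_ + _).
  by apply: eq_bigr => i /negbTE ->.
Qed.

Lemma ge0_integral_law_llr a c (P Q : probability V R) (f : V -> \bar R) :
  normal_law a P -> normal_law c Q ->
  measurable_fun setT f -> (forall z, 0 <= f z)%E ->
  (\int[P]_z f z = \int[Q]_z (f z * (expR (law_llr a c z))%:E))%E.
Proof.
by apply: (@ge0_integral_law_llr_prefix n) => // i; rewrite leqNgt ltn_ord.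
Qed.

Definition tshift (v : 'I_n -> R) (z : V) : V := [tuple tnth z i + v i | i < n].

Lemma measurable_tshift v : measurable_fun setT (tshift v).
Proof.
apply/measurable_fun_tnthP => i /=.
rewrite (_ : _ \o _ = fun z : V => tnth z i + v i).
  by apply: measurable_funD => //; exact: measurable_tnth.
by apply/funext => z /=; rewrite tnth_mktuple.
Qed.

HB.instance Definition _ v :=
  isMeasurableFun.Build _ _ _ _ (tshift v) (measurable_tshift v).

Lemma normal_law_tshift a v (P : probability V R) :
  normal_law a P -> normal_law (fun i => a i + v i) (distribution P (tshift v)).
Proof.
move=> hP A mA; rewrite /= /distribution /pushforward.
have -> : tshift v @^-1` tbox A = tbox (fun i => (fun x => x + v i) @^-1` A i).
  by apply/seteqP; split => z /= h i; have := h i; rewrite /= tnth_mktuple.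
have mc i : measurable_fun setT ((fun x => x + v i) : RR -> RR) by apply: measurable_funD.
have mB i : measurable ((fun x => x + v i) @^-1` A i : set RR).
  by rewrite -[X in measurable X]setTI; exact: mc.
apply: (etrans (hP _ mB)); apply: eq_bigr => i _; exact: (normal_prob_shift s0 (a i) (v i) (mA i)).
Qed.

(* Pointwise, with q >= 1, LR <= e + e^(1-q) LR^q, and LR^q is a constant times
   the likelihood ratio of the q times larger shift, which integrates to 1. *)
Lemma normal_law_change a (c q : R) (P Q : probability V R) (S : set V) :
  normal_law a P -> normal_law (fun=> c) Q -> measurable S -> 1 <= q ->
  (P S <= (expR 1)%:E * Q S +
    (expR (1 - q + q * (q - 1) * (\sum_(i < n) (a i - c) ^+ 2) / (2 * s ^+ 2)))%:E)%E.
Proof.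
move=> hP hQ mS q1.
set D := \sum_(i < n) _; set k := expR (1 - q + _).
pose b i := c + q * (a i - c).
have llrb z : law_llr b (fun=> c) z = q * law_llr a (fun=> c) z - q * (q - 1) * D / (2 * s ^+ 2).
  rewrite /law_llr /D !big_distrr /= mulr_suml -sumrB; apply: eq_bigr => i _.
  rewrite /normal_llr /b; field; rewrite gt_eqF //.
have k0 : 0 <= k by exact: expR_ge0.
have me a' : measurable_fun setT (fun z : V => (expR (law_llr a' (fun=> c) z))%:E).
  by apply/measurable_EFinP; apply: measurableT_comp => //; exact: measurable_law_llr.
have intb : (\int[Q]_z (expR (law_llr b (fun=> c) z))%:E = 1)%E.
  have hb := normal_law_tshift (fun i => q * (a i - c)) hQ.
  have := ge0_integral_law_llr hb hQ (measurable_cst 1%E) (fun=> lee01).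
  rewrite integral_cst //= probability_setT mule1 => ->.
  by apply: eq_integral => z _; rewrite mul1e.
have m1 : measurable_fun setT (fun z : V => (\1_S z)%:E : \bar R).
  by apply/measurable_EFinP; exact: measurable_indic.
have -> : P S = (\int[P]_z (\1_S z)%:E)%E by rewrite integral_indic // setIT.
have -> : Q S = (\int[Q]_z (\1_S z)%:E)%E by rewrite integral_indic // setIT.
rewrite (ge0_integral_law_llr hP hQ m1); last by move=> z; rewrite lee_fin.
rewrite -[X in (_ <= _ + X)%E]mule1 -intb.
rewrite -!ge0_integralZl ?lee_fin ?expR_ge0 //.
have pos1 z : (0 <= (expR 1)%:E * (\1_S z)%:E :> \bar R)%E.
  by rewrite mule_ge0 // lee_fin ?expR_ge0.
have pos2 z : (0 <= k%:E * (expR (law_llr b (fun=> c) z))%:E :> \bar R)%E.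
  by rewrite mule_ge0 // lee_fin ?expR_ge0.
have mf1 : measurable_fun setT (fun z : V => (expR 1)%:E * (\1_S z)%:E : \bar R)%E.
  exact: emeasurable_funM.
have mf2 : measurable_fun setT (fun z : V => k%:E * (expR (law_llr b (fun=> c) z))%:E)%E.
  exact: emeasurable_funM.
rewrite -(ge0_integralD Q measurableT (fun z _ => pos1 z) mf1 (fun z _ => pos2 z) mf2).
apply: ge0_le_integral => //.
- exact: emeasurable_funM.
- exact: emeasurable_funD.
move=> z _; rewrite -!EFinM -EFinD lee_fin llrb /k -expRD indicE.
set l := law_llr a _ z.
have -> : 1 - q + q * (q - 1) * D / (2 * s ^+ 2) + (q * l - q * (q - 1) * D / (2 * s ^+ 2))
  = 1 - q + q * l by ring.
case: (z \in S); last by rewrite mul0r mulr0 add0r expR_ge0.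
(* With [l] the log-likelihood ratio: if [l <= 1] the first term suffices; otherwise
   [l <= 1 - q + q * l], as [(q - 1) * (l - 1) >= 0]. *)
rewrite mul1r mulr1; have [l1|l1] := leP l 1.
  by rewrite ler_wpDr ?expR_ge0 // ler_expR.
rewrite ler_wpDl ?expR_ge0 // ler_expR.
have : 0 <= (q - 1) * (l - 1) by rewrite mulr_ge0 ?subr_ge0 // ltW.
lra.
Qed.

End normal_product_laws.

Section coordinate_selection.
Context {R : realType} (s : R) (m n : nat).
Local Notation RR := (measurableTypeR R).

Definition tsel (f : 'I_m -> 'I_n) (z : n.-tuple RR) : m.-tuple RR := [tuple tnth z (f i) | i < m].

Lemma measurable_tsel f : measurable_fun setT (tsel f).
Proof.
apply/measurable_fun_tnthP => i /=.
rewrite (_ : _ \o _ = fun z : n.-tuple RR => tnth z (f i)); first exact: measurable_tnth.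
by apply/funext => z /=; rewrite tnth_mktuple.
Qed.

HB.instance Definition _ f :=
  isMeasurableFun.Build _ _ _ _ (tsel f) (measurable_tsel f).

Lemma normal_law_tsel (f : 'I_m -> 'I_n) (a : 'I_n -> R) (P : probability (n.-tuple RR) R) :
  injective f -> normal_law s a P -> normal_law s (a \o f) (distribution P (tsel f)).
Proof.
move=> fi hP A mA; rewrite /= /distribution /pushforward.
(* The preimage box has side [A i] at the selected coordinate [f i] and full sides at unselected
   coordinates. *)
pose B j := if [pick i | f i == j] is Some i then A i else setT.
have Bf i : B (f i) = A i.
  rewrite /B; case: pickP => [i' /eqP /fi -> //|/(_ i)]; by rewrite eqxx.
have Bn j : j \notin f @: [set: 'I_m] -> B j = setT.
  rewrite /B; case: pickP => // i /eqP <-; by rewrite imset_f // in_setT.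
have -> : tsel f @^-1` tbox A = tbox B.
  apply/seteqP; split => z /= h i; last by rewrite tnth_mktuple -Bf; exact: h.
  rewrite /B; case: pickP => // k /eqP <-.
  by have := h k; rewrite tnth_mktuple.
have mB j : measurable (B j) by rewrite /B; case: pickP.
apply: (etrans (hP _ mB)).
rewrite (bigID (fun j => j \in f @: [set: 'I_m])) /= [X in (_ * X)%E]big1 ?mule1; last first.
  by move=> j /Bn ->; exact: probability_setT.
rewrite big_imset /=; last by move=> i j _ _; exact: fi.
by apply: eq_big => [i|i _]; rewrite ?in_setT ?Bf.
Qed.

End coordinate_selection.

(** * Vertices and faces of the convex minorant *)

Section faces.
Context {R : realType}.
Implicit Types (u y : nat -> R).

Definition psum u b d : R := \sum_(i < d) u (b + i)%N.

Lemma psum_nat u b d : \sum_(b <= t < b + d) u t = psum u b d.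
Proof.
rewrite -{1}[b]add0n big_addn addKn big_mkord.
by apply: eq_bigr => i _; rewrite addnC.
Qed.

Lemma psumD u b d e : psum u b (d + e) = psum u b d + psum u (b + d) e.
Proof.
rewrite /psum big_split_ord /=; congr (_ + _).
by apply: eq_bigr => i _; rewrite addnA.
Qed.

Lemma eq_psum u y j k t : (forall i, (i < t)%N -> y (j + i)%N = u (k + i)%N) ->
  psum y j t = psum u k t.
Proof. by move=> h; apply: eq_bigr => i _; exact: h. Qed.

Definition pavg u b d : R := psum u b d / d%:R.

Definition above_chord u j l :=
  forall t, (0 < t)%N -> (t < l)%N -> t%:R * pavg u j l < psum u j t.

(** The walk with increments [u t - a], for [t] from [l] to [m - 1], reaches its minimum for the
    first time after [j] steps. *)
Definition first_min_at u l (a : R) m j :=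
  (forall b d, (b + d = j)%N -> (0 < d)%N -> psum u (l + b) d < d%:R * a) /\
  (forall d, (l + j + d <= m)%N -> d%:R * a <= psum u (l + j) d).

(* Strict inequalities inside the face and on its left, weak ones on its right: ties
   then never produce two first minima, and no null event has to be discarded. *)
Definition face u m j l :=
  [/\ above_chord u j l,
      forall b d, (b + d = j)%N -> (0 < d)%N -> psum u b d < d%:R * pavg u j l &
      forall d, (j + l + d <= m)%N -> d%:R * pavg u j l <= psum u (j + l) d].

Lemma vertex_psum u m k : (k < m)%N -> vertex u 0 m k ->
  forall b d e, (b + d = k)%N -> (0 < d)%N -> (0 < e)%N -> (k + e <= m)%N ->
  pavg u b d < pavg u k e.
Proof.
move=> km vk b d e bdk d0 e0 kem.
have bk : (0 <= b < k)%N by rewrite -bdk -[X in (X < _)%N]addn0 ltn_add2l.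
have ke : (k < k + e <= m)%N by rewrite kem andbT -[X in (X < _)%N]addn0 ltn_add2l.
have := vk _ _ bk ke.
have -> : \sum_(b <= t < k) u t = psum u b d by rewrite -bdk psum_nat.
have -> : (k - b = d)%N by rewrite -bdk addKn.
rewrite psum_nat addKn.
by rewrite /pavg ltr_pdivrMr ?ltr0n // mulrAC ltr_pdivlMr ?ltr0n.
Qed.

(** Take for [l] the shortest length minimising the average of [u] from [k] on. Being shortest gives
    the strict chord condition, minimality the condition on the right, and the vertex property the
    one on the left. *)
Lemma vertex_face u m k : (k < m)%N -> vertex u 0 m k ->
  exists2 l, (0 < l <= m - k)%N & face u m k l.
Proof.
move=> km vk; have hv := vertex_psum km vk.
pose N := (m - k)%N.
have N0 : (0 < N)%N by rewrite subn_gt0.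
pose P l := [&& (0 < l)%N, (l <= N)%N &
   [forall e : 'I_N.+1, (0 < e)%N ==> (pavg u k l <= pavg u k e)]].
have exP : exists l, P l.
  case: (@arg_minP _ _ _ (ord_max : 'I_N.+1) (fun e : 'I_N.+1 => (0 < e)%N)
     (fun e : 'I_N.+1 => pavg u k e) N0) => l l0 lmin.
  exists l; rewrite /P l0 -ltnS ltn_ord /=.
  by apply/forallP => e; apply/implyP => /lmin.
case: (ex_minnP exP) => l /and3P[l0 lN /forallP lmin] lfirst.
have lR : 0 < l%:R :> R by rewrite ltr0n.
have kle e : (0 < e)%N -> (k + e <= m)%N -> pavg u k l <= pavg u k e.
  move=> e0 kem; have eN : (e < N.+1)%N by rewrite ltnS leq_subRL // ltnW.
  by have /implyP/(_ e0) := lmin (Ordinal eN).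
have klm : (k + l <= m)%N by rewrite -leq_subRL // ltnW.
exists l; rewrite ?l0 //; split.
- move=> t t0 tl; rewrite mulrC -ltr_pdivlMr ?ltr0n // -/(pavg u k t).
  rewrite ltNge; apply/negP => h.
  have : P t.
    rewrite /P t0 (leq_trans (ltnW tl) lN); apply/forallP => e; apply/implyP => e0.
    by apply: le_trans h _; have /implyP/(_ e0) := lmin e.
  by move/lfirst; rewrite leqNgt tl.
- move=> b d bd d0; rewrite mulrC -ltr_pdivrMr ?ltr0n //.
  exact: hv bd d0 l0 klm.
- move=> d kld; case: d kld => [|d] kld; first by rewrite mul0r /psum big_ord0.
  have := kle (l + d.+1)%N; rewrite addnA kld addn_gt0 l0 => /(_ isT isT).
  rewrite {2}/pavg psumD ler_pdivlMr ?ltr0n ?addn_gt0 ?l0 // natrD mulrDr.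
  by rewrite {1}/pavg divfK ?gt_eqF // lerD2l mulrC.
Qed.

Lemma first_min_at_inj u l (a : R) m j j' : (l + j <= m)%N -> (l + j' <= m)%N ->
  first_min_at u l a m j -> first_min_at u l a m j' -> j = j'.
Proof.
wlog jj : j j' / (j < j')%N => [H|] jm jm' hj hj'.
  by case: (ltngtP j j') => // h; [exact: H|apply/esym/H].
have [_ h1] := hj; have [h2 _] := hj'.
have e : (j + (j' - j) = j')%N by rewrite subnKC // ltnW.
have := h2 _ _ e; rewrite subn_gt0 jj => /(_ isT).
by rewrite ltNge h1 // -addnA e.
Qed.

(** Composing a sequence with this map inserts its first [l] entries at place [j] and moves the
    following [j] entries to the front. *)
Definition block_move (l j i : nat) : nat :=
  if (i < j)%N then (l + i)%N else if (i < j + l)%N then (i - j)%N else i.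

(** With the face cut out and put in front, its chord condition no longer involves [j]; the outer
    conditions say that the remaining increments, glued together, have their first minimum at [j],
    which only one [j] can satisfy. *)
Lemma face_block_move u y m j l : (l + j <= m)%N ->
  (forall i, (i < m)%N -> y i = u (block_move l j i)) -> face y m j l ->
  above_chord u 0 l /\ first_min_at u l (pavg u 0 l) m j.
Proof.
move=> ljm yu [h1 h2 h3].
have e1 t : (t <= l)%N -> psum y j t = psum u 0 t.
  move=> tl; apply: eq_psum => i it.
  have il := leq_trans it tl.
  rewrite yu; last by rewrite (leq_trans _ ljm) // addnC ltn_add2r.
  by rewrite /block_move ltnNge leq_addr /= ltn_add2l il addKn.
have ea : pavg y j l = pavg u 0 l by rewrite /pavg e1.
rewrite /above_chord ea in h1 h2 h3; split; [|split].
- by move=> t t0 tl; rewrite -e1 ?h1 // ltnW.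
- move=> b d bd d0; rewrite (_ : psum u (l + b) d = psum y b d) ?h2 //.
  apply/esym/eq_psum => i id.
  have bij : (b + i < j)%N by rewrite -bd ltn_add2l.
  rewrite yu ?/block_move ?bij ?addnA //.
  by rewrite (leq_trans bij) // (leq_trans _ ljm) // leq_addl.
- move=> d ljd; rewrite [(l + j)%N]addnC in ljd *.
  rewrite (_ : psum u (j + l) d = psum y (j + l) d) ?h3 //.
  apply/esym/eq_psum => i id.
  rewrite yu; last by rewrite (leq_trans _ ljd) // ltn_add2l.
  by rewrite /block_move !ltnNge leq_addr -addnA leq_addr.
Qed.

Definition rotation (l r i : nat) : nat := if (i < l)%N then ((i + r) %% l)%N else i.

Lemma psum_rotation u y m l r : (r < l <= m)%N ->
  (forall i, (i < m)%N -> y i = u (rotation l r i)) ->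
  (forall t, (t <= l - r)%N -> psum y 0 t = psum u r t) /\
  (forall t, (t <= r)%N -> psum y 0 (l - r + t) = psum u r (l - r) + psum u 0 t).
Proof.
move=> /andP[rl lm] yu.
have h1 t : (t <= l - r)%N -> psum y 0 t = psum u r t.
  move=> tl; apply: eq_psum => i it; rewrite add0n.
  have irl : (i + r < l)%N by rewrite addnC -ltn_subRL (leq_trans it).
  have il : (i < l)%N by rewrite (leq_ltn_trans _ irl) // leq_addr.
  by rewrite yu ?(leq_trans il) // /rotation il modn_small // addnC.
split=> // t tr; rewrite psumD h1 //; congr (_ + _); apply: eq_psum => i it.
rewrite !add0n.
have ir := leq_trans it tr.
have il : (l - r + i < l)%N by rewrite -ltn_subRL subKn // ltnW.
rewrite yu ?(leq_trans il) // /rotation il addnAC subnK 1?ltnW // -{1}[l]mul1n.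
by rewrite modnMDl modn_small // (ltn_trans ir).
Qed.

(** One rotation forces the stretch from [r] to [r'] above the mean slope, the other forces the
    complementary stretch from [r'] round to [r] above it. Their total would exceed the sum over the
    whole cycle. *)
Lemma above_chord_rotation u y y' m l r r' : (r < r')%N -> (r' < l)%N -> (l <= m)%N ->
  (forall i, (i < m)%N -> y i = u (rotation l r i)) ->
  (forall i, (i < m)%N -> y' i = u (rotation l r' i)) ->
  above_chord y 0 l -> above_chord y' 0 l -> False.
Proof.
move=> rr rl lm yr yr'.
have l0 : (0 < l)%N by apply: leq_ltn_trans rl.
have lR : (l%:R : R) != 0 by rewrite pnatr_eq0 -lt0n.
have rl' := ltn_trans rr rl.
have rlm : (r < l <= m)%N by rewrite rl'.
have rlm' : (r' < l <= m)%N by rewrite rl.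
have [a1 a2] := psum_rotation rlm yr.
have [b1 b2] := psum_rotation rlm' yr'.
have tot : psum u 0 l = psum u 0 r + psum u r (l - r).
  by rewrite -{1}(subnKC (ltnW rl')) psumD.
have tot' : psum u 0 l = psum u 0 r' + psum u r' (l - r').
  by rewrite -{1}(subnKC (ltnW rl)) psumD.
have E : psum y 0 l = psum u 0 l.
  by rewrite -{1}(subnK (ltnW rl')) a2 // tot addrC.
have E' : psum y' 0 l = psum u 0 l.
  by rewrite -{1}(subnK (ltnW rl)) b2 // tot' addrC.
rewrite /above_chord /pavg E E' => h h'.
have d0 : (0 < r' - r)%N by rewrite subn_gt0.
have dl : (r' - r < l)%N by rewrite (leq_ltn_trans (leq_subr _ _)).
have := h _ d0 dl; rewrite a1; last by rewrite leq_sub2r // ltnW.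
have l'0 : (0 < l - r' + r)%N by rewrite addn_gt0 subn_gt0 rl.
have l'l : (l - r' + r < l)%N by rewrite -ltn_subRL subKn // ltnW.
have := h' _ l'0 l'l; rewrite b2; last exact: ltnW.
have := tot; rewrite -[X in psum u r X](_ : (r' - r + (l - r') = l - r)%N); last first.
  by rewrite addnC addnBA ?subnK // ltnW.
rewrite psumD subnKC; last exact: ltnW.
set A := psum u 0 l / l%:R.
have AE : psum u 0 l = l%:R * A by rewrite /A mulrC divfK.
rewrite AE natrD !natrB; try exact: ltnW.
lra.
Qed.

End faces.

(** * Measurability of quantified events and measures of unions *)

Section measurable_quantifiers.
Context d (T : measurableType d).

Lemma measurable_forall (P : nat -> set T) : (forall k, measurable (P k)) ->
  measurable [set z | forall k, P k z].
Proof.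
move=> mP; rewrite (_ : [set z | _] = \bigcap_k P k); first exact: bigcapT_measurable.
by apply/seteqP; split => z h k => [_|]; exact: h.
Qed.

Lemma measurable_imply (B : Prop) (Q : set T) : measurable Q ->
  measurable [set z | B -> Q z].
Proof.
move=> mQ; have [b|nb] := pselect B.
  rewrite (_ : [set z | _] = Q) //; apply/seteqP; split => z /=; last by [].
  exact.
by rewrite (_ : [set z | _] = setT) //; apply/seteqP; split => // z _ /nb.
Qed.

Lemma measurable_lt_set (R : realType) (f g : T -> R) :
  measurable_fun setT f -> measurable_fun setT g -> measurable [set z | f z < g z].
Proof.
move=> mf mg; rewrite -[X in measurable X]setTI.
by apply: (measurable_fun_ltr mf mg measurableT (Y := [set true])).
Qed.

Lemma measurable_le_set (R : realType) (f g : T -> R) :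
  measurable_fun setT f -> measurable_fun setT g -> measurable [set z | f z <= g z].
Proof.
move=> mf mg; rewrite -[X in measurable X]setTI.
by apply: (measurable_fun_ler mf mg measurableT (Y := [set true])).
Qed.

Lemma sum_disjoint_le (R : realType) (P : {measure set T -> \bar R}) (N : nat)
    (A : nat -> set T) (B : set T) :
  (forall j, (j < N)%N -> measurable (A j)) -> measurable B ->
  (forall j, (j < N)%N -> A j `<=` B) ->
  (forall i j z, (i < N)%N -> (j < N)%N -> A i z -> A j z -> i = j) ->
  (\sum_(j < N) P (A j) <= P B)%E.
Proof.
move=> mA mB AB dA.
have tA : trivIset [set: 'I_N] (fun j => A j).
  by apply/trivIsetP => i j _ _ /eqP ij; apply/seteqP; split => // z [/= Ai Aj];
     apply: ij; apply/val_inj; exact: dA Ai Aj.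
rewrite -(@measure_bigsetU_ord _ _ _ P N xpredT (fun j => A j)) //; last by move=> i; exact: mA.
apply: le_measure; rewrite ?inE //.
  by apply: bigsetU_measurable => i _; exact: mA.
by rewrite -bigcup_seq /= => z [j _]; exact: AB.
Qed.

Lemma measure_bigsetU_le (R : realType) (P : {measure set T -> \bar R}) (I : Type)
    (r : seq I) (p : pred I) (F : I -> set T) : (forall i, measurable (F i)) ->
  (P (\big[setU/set0]_(i <- r | p i) F i) <= \sum_(i <- r | p i) P (F i))%E.
Proof.
move=> mF; elim: r => [|i r IH]; first by rewrite !big_nil measure0.
rewrite !big_cons; case: ifP => // _.
apply: (@le_trans _ _ (P (F i) + P (\big[setU/set0]_(j <- r | p j) F j))%E).
  by apply: measureU2 => //; exact: bigsetU_measurable.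
exact: leeD2l.
Qed.

End measurable_quantifiers.

Section tuple_sums.
Context {R : realType} (m : nat).
Local Notation RR := (measurableTypeR R).
Local Notation V := (m.-tuple RR).

Definition tcoord (z : V) (t : nat) : R := nth 0 z t.

Lemma measurable_tcoord t : measurable_fun setT (fun z : V => tcoord z t).
Proof.
have [tm|tm] := ltnP t m.
  rewrite (_ : (fun _ => _) = fun z : V => tnth z (Ordinal tm)).
    exact: (@measurable_tnth _ RR).
  by apply/funext => z; rewrite (tnth_nth 0).
rewrite (_ : (fun _ => _) = fun=> 0) //.
by apply/funext => z; rewrite /tcoord nth_default // size_tuple.
Qed.

Lemma measurable_tsum a b : measurable_fun setT (fun z : V => \sum_(a <= t < b) tcoord z t).
Proof. by apply: measurable_sum => t; exact: measurable_tcoord. Qed.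

Lemma measurable_tpsum a b : measurable_fun setT (fun z : V => psum (tcoord z) a b).
Proof. by apply: measurable_sum => t; exact: measurable_tcoord. Qed.

Lemma measurable_tpavg a b : measurable_fun setT (fun z : V => pavg (tcoord z) a b).
Proof. by apply: measurable_funM => //; exact: measurable_tpsum. Qed.

Lemma measurable_vertex lo hi k : measurable [set z : V | vertex (tcoord z) lo hi k].
Proof.
apply: measurable_forall => a; apply: measurable_forall => b.
apply: measurable_imply; apply: measurable_imply.
by apply: measurable_lt_set; apply: measurable_funM => //; exact: measurable_tsum.
Qed.

Lemma measurable_above_chord j l : measurable [set z : V | above_chord (tcoord z) j l].
Proof.
apply: measurable_forall => t; apply: measurable_imply; apply: measurable_imply.
apply: measurable_lt_set; last exact: measurable_tpsum.
by apply: measurable_funM => //; exact: measurable_tpavg.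
Qed.

Lemma measurable_face j l : measurable [set z : V | face (tcoord z) m j l].
Proof.
rewrite (_ : [set z | _] = [set z : V | above_chord (tcoord z) j l] `&`
   ([set z | forall b d, (b + d = j)%N -> (0 < d)%N -> psum (tcoord z) b d < d%:R * pavg (tcoord z) j l] `&`
    [set z | forall d, (j + l + d <= m)%N -> d%:R * pavg (tcoord z) j l <= psum (tcoord z) (j + l) d])).
  apply: measurableI; first exact: measurable_above_chord.
  apply: measurableI.
    apply: measurable_forall => b; apply: measurable_forall => d.
    apply: measurable_imply; apply: measurable_imply.
    apply: measurable_lt_set; first exact: measurable_tpsum.
    by apply: measurable_funM => //; exact: measurable_tpavg.
  apply: measurable_forall => d; apply: measurable_imply.
  apply: measurable_le_set; last exact: measurable_tpsum.
  by apply: measurable_funM => //; exact: measurable_tpavg.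
by apply/seteqP; split => z /= [] // a [b c].
Qed.

(** The default of [insubd] is reached only if [f i] is out of range, which the lemmas below exclude
    by hypothesis. *)
Definition ord_map (f : nat -> nat) (i : 'I_m) : 'I_m := insubd i (f i).

Lemma tcoord_tsel (f : nat -> nat) (z : V) :
  (forall i, (i < m)%N -> (f i < m)%N) ->
  forall i, (i < m)%N -> tcoord (tsel (ord_map f) z) i = tcoord z (f i).
Proof.
move=> fm i im; rewrite /tcoord -(tnth_nth 0 _ (Ordinal im)) tnth_mktuple.
by rewrite (tnth_nth 0) /ord_map val_insubd /= fm.
Qed.

Lemma ord_map_inj (f : nat -> nat) : (forall i, (i < m)%N -> (f i < m)%N) ->
  (forall i j, (i < m)%N -> (j < m)%N -> f i = f j -> i = j) -> injective (ord_map f).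
Proof.
move=> fm fi i j /(congr1 val); rewrite !val_insubd !fm // => h.
by apply/val_inj; apply: (fi _ _ (ltn_ord i) (ltn_ord j)).
Qed.

End tuple_sums.

(** * Expected number of vertices for exchangeable increments *)

Section iid_vertices.
Context {R : realType} (s c : R) (m : nat).
Hypothesis s0 : 0 < s.
Local Notation RR := (measurableTypeR R).
Local Notation V := (m.-tuple RR).
Variable (Q : probability V R).
Hypothesis hQ : normal_law s (fun=> c) Q.

Lemma iid_exchange (f : 'I_m -> 'I_m) (S : set V) : injective f -> measurable S ->
  Q (tsel f @^-1` S) = Q S.
Proof.
by move=> fi mS; exact: (normal_law_unique (normal_law_tsel fi hQ) hQ mS).
Qed.

Lemma block_move_lt j l i : (l + j <= m)%N -> (i < m)%N -> (block_move l j i < m)%N.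
Proof. by rewrite /block_move => h im; do ?[case: ifP => ?]; lia. Qed.

Lemma block_move_inj j l i i' : (l + j <= m)%N -> (i < m)%N -> (i' < m)%N ->
  block_move l j i = block_move l j i' -> i = i'.
Proof. by rewrite /block_move => h im i'm; do ?[case: ifP => ?]; lia. Qed.

Lemma rotationE l r i : (r < l)%N -> rotation l r i =
  if (i < l)%N then if (i + r < l)%N then (i + r)%N else (i + r - l)%N else i.
Proof.
move=> rl; rewrite /rotation; case: (ltnP i l) => // il.
case: (ltnP (i + r) l) => h; first by rewrite modn_small.
have hl : (i + r - l < l)%N by lia.
by rewrite -{1}(subnK h) modnDr (modn_small hl).
Qed.

Lemma rotation_lt l r i : (r < l)%N -> (l <= m)%N -> (i < m)%N -> (rotation l r i < m)%N.
Proof. by move=> rl lm im; rewrite rotationE //; do ?[case: ifP => ?]; lia. Qed.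

Lemma rotation_inj l r i i' : (r < l)%N -> rotation l r i = rotation l r i' -> i = i'.
Proof. by move=> rl; rewrite !rotationE //; do ?[case: ifP => ?]; lia. Qed.

(** The [l] rotations of the event have equal probability and are disjoint. *)
Lemma iid_above_chord l : (l <= m)%N ->
  (l%:R%:E * Q [set z | above_chord (tcoord z) 0 l] <= 1)%E.
Proof.
move=> lm; set I := [set z | _].
have mI : measurable I by exact: measurable_above_chord.
pose A r := tsel (ord_map (m := m) (rotation l r)) @^-1` I.
have mA r : measurable (A r).
  by rewrite -[A r]setTI; exact: measurable_tsel.
have -> : (l%:R%:E * Q I = \sum_(r < l) Q (A r))%E.
  rewrite (eq_bigr (fun=> Q I)); last first.
    move=> r _; apply: iid_exchange => //; apply: ord_map_inj.
      by move=> i; exact: rotation_lt.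
    by move=> i j _ _; exact: rotation_inj.
  rewrite -(fineK (fin_num_measure Q _ mI)) sumEFin sumr_const card_ord.
  by rewrite -EFinM mulr_natl.
have disj r r' z : (r < r')%N -> (r' < l)%N -> A r z -> A r' z -> False.
  move=> rr' r'l; apply: (above_chord_rotation (u := tcoord z) rr' r'l lm).
    by move=> i im; apply: tcoord_tsel => // i'; apply: rotation_lt; rewrite // (ltn_trans rr').
  by move=> i im; apply: tcoord_tsel => // i'; exact: rotation_lt.
apply: (@le_trans _ _ (Q setT)); last by rewrite probability_setT.
apply: sum_disjoint_le => // r r' z rl r'l Ar Ar'.
by case: (ltngtP r r') => // h; [case: (disj _ _ _ h r'l Ar Ar')|case: (disj _ _ _ h rl Ar' Ar)].
Qed.

(** Rearranging by [block_move] preserves each probability and turns the events into disjoint parts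
    of the single event [I], of probability at most [1 / l]. *)
Lemma iid_face l : (0 < l <= m)%N ->
  (\sum_(j < (m - l).+1) Q [set z | face (tcoord z) m j l] <= (l%:R^-1)%:E)%E.
Proof.
move=> /andP[l0 lm]; pose F j := [set z : V | face (tcoord z) m j l].
pose A j := tsel (ord_map (m := m) (block_move l j)) @^-1` F j.
have mF j : measurable (F j) by exact: measurable_face.
have mA j : measurable (A j).
  by rewrite -[A j]setTI; exact: measurable_tsel.
have jm (j : nat) : (j < (m - l).+1)%N -> (l + j <= m)%N.
  by rewrite ltnS -leq_subRL.
rewrite (eq_bigr (fun j : 'I_(m - l).+1 => Q (A j))); last first.
  move=> j _; apply/esym/iid_exchange => //; apply: ord_map_inj.
    by move=> i; apply: block_move_lt; exact: jm.
  by move=> i i'; apply: block_move_inj; exact: jm.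
pose I := [set z : V | above_chord (tcoord z) 0 l].
have Amin j z : (j < (m - l).+1)%N -> A j z ->
    I z /\ first_min_at (tcoord z) l (pavg (tcoord z) 0 l) m j.
  move=> /jm ljm; apply: (face_block_move ljm).
  by move=> i im; apply: tcoord_tsel => // i'; exact: block_move_lt.
apply: (@le_trans _ _ (Q I)).
  apply: sum_disjoint_le => //; first exact: measurable_above_chord.
    by move=> j jl z /(Amin _ _ jl)[].
  move=> i j z il jl /(Amin _ _ il)[_ hi] /(Amin _ _ jl)[_ hj].
  exact: first_min_at_inj (jm _ il) (jm _ jl) hi hj.
have := iid_above_chord lm; rewrite -/I muleC -lee_pdivlMr ?ltr0n // mul1e.
by [].
Qed.

(** Every vertex [k < m] opens a face of some length [l <= m - k]; for fixed [l] the sum over places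
    is at most [1 / l]. *)
Lemma iid_vertices :
  (\sum_(k < m) Q [set z | vertex (tcoord z) 0 m k] <= (\sum_(1 <= l < m.+1) l%:R^-1)%:E)%E.
Proof.
pose F j l := [set z : V | face (tcoord z) m j l].
apply: (@le_trans _ _ (\sum_(k < m) \sum_(1 <= l < m.+1 | (l <= m - k)%N) Q (F k l)))%E.
  apply: lee_sum => k _.
  apply: (@le_trans _ _ (Q (\big[setU/set0]_(1 <= l < m.+1 | (l <= m - k)%N) F k l))).
    apply: le_measure; rewrite ?inE; first exact: measurable_vertex.
      by apply: bigsetU_measurable => l _; exact: measurable_face.
    move=> z /= /(vertex_face (ltn_ord k)) [l /andP[l0 lm] Fl].
    rewrite -bigcup_seq_cond; exists l => //=; rewrite mem_index_iota l0 lm ltnS andbT.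
    by rewrite (leq_trans lm) // leq_subr.
  by apply: measure_bigsetU_le => l; exact: measurable_face.
rewrite (exchange_big_dep xpredT) //= -sumEFin !big_nat.
apply: lee_sum => l /andP[l0]; rewrite ltnS => lm.
have ll : (0 < l <= m)%N by rewrite l0.
apply: le_trans (iid_face ll).
apply: (@le_trans _ _ (\sum_(0 <= k < m | (l <= m - k)%N) Q (F k l))%E); first by rewrite big_mkord.
apply: (@le_trans _ _ (\sum_(0 <= k < (m - l).+1) Q (F k l))%E); last by rewrite big_mkord.
rewrite [leRHS](big_nat_widen _ _ m) /=; last by rewrite ltn_subrL l0 (leq_trans l0 lm).
rewrite le_eqVlt; apply/orP; left; apply/eqP; rewrite big_nat_cond [RHS]big_nat_cond.
by apply: eq_bigl => k; rewrite /= ltnS; apply: andb_id2l => km; lia.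
Qed.

End iid_vertices.

(** * Vertices in a window of a slowly varying signal *)

Lemma harmonic_le {R : realType} (m : nat) : (0 < m)%N ->
  \sum_(1 <= l < m.+1) l%:R^-1 <= 1 + ln m%:R :> R.
Proof.
elim: m => // -[|m] IH _; first by rewrite big_nat1 ln1 invr1 addr0.
rewrite big_nat_recr //=; have {IH} := IH isT.
set S := \sum_(_ <= _ < _) _ => IH.
have m2 : 0 < m.+2%:R :> R by [].
have m1 : 0 < m.+1%:R :> R by [].
(* This is [ln (1 + x) <= x] at [x = - 1 / (m + 2)]. *)
suff : ln (m.+1%:R : R) <= ln m.+2%:R - m.+2%:R^-1.
  by move=> h; rewrite -lerBrDr (le_trans IH) // -addrA lerD2l.
have -> : (m.+1%:R : R) = m.+2%:R * (1 + - m.+2%:R^-1).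
  by rewrite mulrDr mulr1 mulrN mulfV ?gt_eqF // -(natr1 m.+1) addrK.
have lt1 : (m.+2%:R : R)^-1 < 1 by rewrite invf_lt1 // ltr1n.
rewrite lnM ?posrE //; last by rewrite subr_gt0.
by rewrite lerD2l le_ln1Dx // ltrN2.
Qed.

Section window_vertices.
Context {R : realType} (s : R).
Hypothesis s0 : 0 < s.
Local Notation RR := (measurableTypeR R).

(** Each vertex event is compared with its probability under the constant mean [c]. The bound on
    [q * D] brings the error exponent below [1 - q + (q - 1) / 2], hence below [1 - q / 2]. *)
Lemma near_iid_vertices (m : nat) (a : 'I_m -> R) (c q : R) (P : probability (m.-tuple RR) R) :
  (0 < m)%N -> normal_law s a P -> 1 <= q ->
  q * \sum_(i < m) (a i - c) ^+ 2 <= s ^+ 2 ->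
  (\sum_(k < m) P [set z | vertex (tcoord z) 0 m k] <=
    (expR 1 * (1 + ln m%:R) + m%:R * expR (1 - q / 2))%:E)%E.
Proof.
move=> m0 hP q1; set D := \sum_(i < m) _ => qD.
pose Q : probability (m.-tuple RR) R := distribution P (tshift (fun i => c - a i)).
have hQ : normal_law s (fun=> c) Q.
  have := normal_law_tshift s0 (fun i => c - a i) hP.
  by rewrite (_ : (fun i => _) = fun=> c) //; apply/funext => i; rewrite addrC subrK.
pose k := expR (1 - q / 2).
have step j : (P [set z | vertex (tcoord z) 0 m j] <=
    (expR 1)%:E * Q [set z | vertex (tcoord z) 0 m j] + k%:E)%E.
  apply: le_trans (normal_law_change s0 hP hQ (measurable_vertex 0 m j) q1) _.
  rewrite leeD2l // lee_fin ler_expR -/D.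
  have s20 : 0 < 2 * s ^+ 2 by rewrite mulr_gt0 // exprn_gt0.
  have : q * (q - 1) * D / (2 * s ^+ 2) <= (q - 1) / 2.
    rewrite ler_pdivrMr //.
    have := ler_wpM2l (_ : 0 <= q - 1) qD; rewrite subr_ge0 q1 => /(_ isT).
    lra.
  lra.
apply: (le_trans (lee_sum _ (fun j _ => step (j : 'I_m)))).
rewrite big_split /= -ge0_sume_distrr // sumEFin sumr_const card_ord EFinD.
apply: leeD; last by rewrite lee_fin mulr_natl.
rewrite EFinM; apply: lee_wpmul2l; first by rewrite lee_fin expR_ge0.
apply: le_trans (iid_vertices s0 hQ) _; rewrite lee_fin; exact: harmonic_le.
Qed.

Lemma vertex_shift (u y : nat -> R) w m k :
  (forall t, (t < m)%N -> y t = u (w + t)%N) ->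
  vertex u w (w + m) (w + k) -> vertex y 0 m k.
Proof.
move=> yu vu a b /andP[_ ak] /andP[kb bm].
have sumE i j : (j <= m)%N -> \sum_(i <= t < j) y t = \sum_(w + i <= t < w + j) u t.
  move=> jm; rewrite [(w + i)%N]addnC big_addn addKn [LHS]big_nat [RHS]big_nat.
  apply: eq_bigr => t /andP[_ tj]; rewrite [(t + w)%N]addnC; apply: yu; exact: leq_trans jm.
have := vu (w + a)%N (w + b)%N; rewrite !subnDl -!sumE //; last first.
  by rewrite ltnW // (leq_trans kb).
by rewrite leq_addr !ltn_add2l ak kb leq_add2l bm => /(_ isT isT).
Qed.

(** A vertex relative to the window depends only on the window coordinates, which again have a
    product normal law. *)
Lemma window_vertices (n m w : nat) (a : 'I_n -> R) (c q : R) (P : probability (n.-tuple RR) R) :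
  (0 < m)%N -> (w + m <= n)%N -> normal_law s a P -> 1 <= q ->
  (forall i : 'I_n, (w <= i < w + m)%N -> q * (m%:R * (a i - c) ^+ 2) <= s ^+ 2) ->
  (\sum_(k < m) P [set z | vertex (tcoord z) w (w + m) (w + k)] <=
    (expR 1 * (1 + ln m%:R) + m%:R * expR (1 - q / 2))%:E)%E.
Proof.
move=> m0 wmn hP q1 ha.
have wi (i : 'I_m) : (w + i < n)%N by rewrite (leq_trans _ wmn) // ltn_add2l.
pose f (i : 'I_m) : 'I_n := Ordinal (wi i).
have fi : injective f by move=> i j /(congr1 val) /= /addnI /val_inj.
have hPf := normal_law_tsel fi hP.
have hD : q * \sum_(i < m) ((a \o f) i - c) ^+ 2 <= s ^+ 2.
  rewrite mulr_sumr.
  apply: (@le_trans _ _ (\sum_(i < m) s ^+ 2 / m%:R)).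
    apply: ler_sum => i _; rewrite ler_pdivlMr ?ltr0n // -mulrA [_ * m%:R]mulrC.
    by apply: ha; rewrite /= leq_addr ltn_add2l ltn_ord.
  by rewrite sumr_const card_ord -[X in X <= _]mulr_natr divfK // pnatr_eq0 -lt0n.
apply: le_trans (near_iid_vertices m0 hPf q1 hD).
apply: lee_sum => k _; apply: le_measure; rewrite ?inE.
- exact: measurable_vertex.
- by rewrite -[X in measurable X]setTI; apply: (measurable_tsel f) => //; exact: measurable_vertex.
move=> z /=; apply: vertex_shift => t tm.
by rewrite /tcoord -(tnth_nth 0 _ (Ordinal tm)) tnth_mktuple (tnth_nth 0).
Qed.

End window_vertices.

(** * The oscillation *)

Section second_difference.
Context {R : realType}.
Implicit Types w : nat -> R.

Lemma increments_lipschitz w (D : R) : (forall t, `|w t.+1 - w t| <= D) ->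
  forall i d, `|w (i + d)%N - w i| <= d%:R * D.
Proof.
move=> hw i; elim=> [|d IH]; first by rewrite addn0 subrr normr0 mul0r.
rewrite addnS -(subrKA (w (i + d)%N)) (le_trans (ler_normD _ _)) //.
by rewrite -natr1 mulrDl mul1r addrC lerD.
Qed.

(** Up to place [i + N] each increment is within [N * D] of the one at [i], and [d] of them are
    added. *)
Lemma increments_linear w (D : R) i N : 0 <= D ->
  (forall t, `|(w t.+2 - w t.+1) - (w t.+1 - w t)| <= D) ->
  forall j d, (i <= j)%N -> (j + d <= i + N)%N ->
  `|w (j + d)%N - w j - d%:R * (w i.+1 - w i)| <= d%:R * (N%:R * D).
Proof.
move=> D0 hD j; elim=> [|d IH] ij jd; first by rewrite addn0 subrr !mul0r subr0 normr0.
rewrite addnS in jd *.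
have h1 := IH ij (ltnW jd).
have h2 : `|(w (j + d).+1 - w (j + d)%N) - (w i.+1 - w i)| <= N%:R * D.
  have ijd : (i <= j + d)%N by rewrite (leq_trans ij) // leq_addr.
  have := @increments_lipschitz (fun t => w t.+1 - w t) D hD i (j + d - i).
  rewrite subnKC // => /le_trans; apply; rewrite ler_wpM2r // ler_nat leq_subLR.
  exact: ltnW.
rewrite -natr1 !mulrDl !mul1r.
rewrite (_ : _ - _ = (w (j + d)%N - w j - d%:R * (w i.+1 - w i)) +
   ((w (j + d).+1 - w (j + d)%N) - (w i.+1 - w i))); last by ring.
by rewrite (le_trans (ler_normD _ _)) // lerD.
Qed.

Lemma interpolation_error w (D : R) i j k : 0 <= D ->
  (forall t, `|(w t.+2 - w t.+1) - (w t.+1 - w t)| <= D) ->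
  (i <= j)%N -> (j <= k)%N -> (i < k)%N ->
  `|w j - ((k - j)%:R / (k - i)%:R * w i + (j - i)%:R / (k - i)%:R * w k)|
    <= D * (k - i)%:R ^+ 2.
Proof.
move=> D0 hD ij jk ik.
have N0 : 0 < (k - i)%:R :> R by rewrite ltr0n subn_gt0.
have e1 := @increments_linear w D i (k - i) D0 hD i (j - i) (leqnn i).
have e2 := @increments_linear w D i (k - i) D0 hD j (k - j) ij.
move: e1 e2; rewrite !subnKC // ?(ltnW ik) // jk => /(_ isT) + /(_ (leqnn k)).
have NE : (k - i)%:R = (k - j)%:R + (j - i)%:R :> R by rewrite -natrD addnBA // subnK.
set J := (j - i)%:R in NE *; set K := (k - j)%:R in NE *; set N := (k - i)%:R in N0 NE *.
have J0 : 0 <= J by []. have K0 : 0 <= K by [].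
set b := w i.+1 - w i => e1 e2.
have f1 := ler_wpM2l K0 e1; have f2 := ler_wpM2l J0 e2.
(* The interpolation error as a combination of the two increments, in which the linear parts with
   slope [b] cancel. *)
rewrite -[X in `|X| <= _](_ : (K * (w j - w i - J * b) - J * (w k - w j - K * b)) / N = _); last first.
  by rewrite NE; field; rewrite -NE gt_eqF.
rewrite normrM [`|N^-1|]gtr0_norm ?invr_gt0 // ler_pdivrMr //.
rewrite (le_trans (ler_normB _ _)) // !normrM (ger0_norm K0) (ger0_norm J0).
rewrite (le_trans (lerD f1 f2)) //.
have : 0 <= D * N * (K ^+ 2 + J ^+ 2) by rewrite !mulr_ge0 ?addr_ge0 ?sqr_ge0 // ltW.
have -> : D * N ^+ 2 * N = D * N * (K + J) ^+ 2 by rewrite -NE; ring.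
lra.
Qed.

End second_difference.

Section parabolic_wave.
Context {R : realType} (p : nat).
Hypothesis p0 : (0 < p)%N.

(** Parabolic arches of length [p] and height at most 1 with alternating signs. Sums over full
    periods vanish, and the slopes match where arches meet, so that second differences are of order
    [p^-2], enough for every [beta <= 2]. *)
Definition wave (t : nat) : R :=
  (-1) ^+ (t %/ p) * (4 * (t %% p)%:R * (p%:R - (t %% p)%:R) / p%:R ^+ 2).

Let pR : 0 < p%:R :> R. Proof. by rewrite ltr0n. Qed.

Let modR t : (t %% p)%:R <= p%:R - 1 :> R.
Proof. by rewrite lerBrDr natr1 ler_nat ltn_mod. Qed.

Lemma waveDp t : wave (t + p) = - wave t.
Proof. by rewrite /wave divnDr // divnn p0 modnDr addn1 exprS mulN1r mulNr. Qed.

Lemma norm_wave t : `|wave t| = 4 * (t %% p)%:R * (p%:R - (t %% p)%:R) / p%:R ^+ 2.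
Proof.
rewrite /wave normrM normrX normrN1 expr1n mul1r ger0_norm //.
have := modR t => h; rewrite !mulr_ge0 ?invr_ge0 ?sqr_ge0 // subr_ge0; lra.
Qed.

Lemma wave_le1 t : `|wave t| <= 1.
Proof.
rewrite norm_wave ler_pdivrMr ?exprn_gt0 // mul1r.
have := sqr_ge0 (p%:R - 2 * (t %% p)%:R : R); rewrite !expr2; lra.
Qed.

(** The formula also covers the last step of an arch, where the next value is 0. *)
Lemma wave_increment t : wave t.+1 - wave t =
  (-1) ^+ (t %/ p) * (4 * (p%:R - 1 - 2 * (t %% p)%:R) / p%:R ^+ 2).
Proof.
have [h|h] := ltnP (t %% p).+1 p.
  have e : t.+1 = (t %/ p * p + (t %% p).+1)%N by rewrite addnS -divn_eq.
  rewrite /wave e modnMDl divnMDl // (divn_small h) addn0 (modn_small h) -natr1.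
  by field; rewrite gt_eqF.
have hp : (t %% p).+1 = p by apply/eqP; rewrite eqn_leq h ltn_mod p0.
have e : t.+1 = ((t %/ p).+1 * p)%N by rewrite {1}(divn_eq t p) -addnS hp mulSn addnC.
have er : (t %% p)%:R = p%:R - 1 :> R by rewrite -[in RHS]hp -natr1 addrK.
rewrite /wave e modnMl mulr0 mul0r mul0r mulr0 sub0r er.
by field; rewrite gt_eqF.
Qed.

Lemma wave_increment_le t : `|wave t.+1 - wave t| <= 4 / p%:R.
Proof.
rewrite wave_increment normrM normrX normrN1 expr1n mul1r.
rewrite normrM [X in _ * X]gtr0_norm ?invr_gt0 ?exprn_gt0 // ler_pdivrMr ?exprn_gt0 //.
have -> : 4 / p%:R * p%:R ^+ 2 = 4 * p%:R :> R by field; rewrite gt_eqF.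
have := modR t => h; have r0 : 0 <= (t %% p)%:R :> R by [].
by rewrite ler_norml; apply/andP; split; lra.
Qed.

Lemma wave_increment2_le t :
  `|(wave t.+2 - wave t.+1) - (wave t.+1 - wave t)| <= 8 / p%:R ^+ 2.
Proof.
rewrite !wave_increment.
have p2 : 0 < p%:R ^+ 2 :> R by rewrite exprn_gt0.
have [h|h] := ltnP (t %% p).+1 p.
  have e : t.+1 = (t %/ p * p + (t %% p).+1)%N by rewrite addnS -divn_eq.
  rewrite e modnMDl divnMDl // (divn_small h) addn0 (modn_small h) -natr1.
  rewrite (_ : _ - _ = - ((-1) ^+ (t %/ p) * (8 / p%:R ^+ 2))); last by field; rewrite gt_eqF.
  rewrite normrN normrM normrX normrN1 expr1n mul1r ger0_norm //.
have hp : (t %% p).+1 = p by apply/eqP; rewrite eqn_leq h ltn_mod p0.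
have e : t.+1 = ((t %/ p).+1 * p)%N by rewrite {1}(divn_eq t p) -addnS hp mulSn addnC.
have er : (t %% p)%:R = p%:R - 1 :> R by rewrite -[in RHS]hp -natr1 addrK.
rewrite e modnMl mulnK // er exprS.
(* Across a join the sign flips and so does the slope of the arch: the two increments coincide. *)
rewrite (_ : _ - _ = 0); last by field; rewrite gt_eqF.
by rewrite normr0; apply/ltW/divr_gt0.
Qed.

Lemma wave_dist i j : (i <= j)%N -> `|wave j - wave i| <= 4 / p%:R * (j - i)%:R.
Proof.
move=> ij; have := increments_lipschitz wave_increment_le i (j - i).
by rewrite subnKC // mulrC.
Qed.

Lemma norm_psum_wave_le b : `|psum wave 0 b| <= b%:R.
Proof.
rewrite /psum (le_trans (ler_norm_sum _ _ _)) //.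
apply: (@le_trans _ _ (\sum_(i < b) 1)); last by rewrite sumr_const card_ord.
by apply: ler_sum => i _; exact: wave_le1.
Qed.

Lemma psum_wave_period a : psum wave a (p + p) = 0.
Proof.
rewrite psumD (_ : psum wave (a + p) p = - psum wave a p) ?subrr //.
by rewrite /psum -sumrN; apply: eq_bigr => i _; rewrite addnAC waveDp.
Qed.

Lemma psum_wave_bounded b : `|psum wave 0 b| <= 2 * p%:R.
Proof.
elim/ltn_ind: b => b IH; have [bp|pb] := leqP b (p + p).
  by rewrite (le_trans (norm_psum_wave_le b)) // -natrM ler_nat mul2n -addnn.
rewrite -(subnKC (ltnW pb)) psumD psum_wave_period add0r.
rewrite (_ : psum _ _ _ = psum wave 0 (b - (p + p))).
  by apply: IH; rewrite ltn_subrL addn_gt0 p0 (leq_trans _ pb).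
by apply: eq_bigr => i _; rewrite add0n addnC addnA !waveDp opprK.
Qed.

Lemma sum_wave_bounded a b : (a <= b)%N -> `|\sum_(a <= t < b) wave t| <= 4 * p%:R.
Proof.
move=> ab; rewrite -{1}(subnKC ab) psum_nat.
have -> : psum wave a (b - a) = psum wave 0 b - psum wave 0 a.
  by rewrite -{2}(subnKC ab) psumD add0n addrAC subrr add0r.
rewrite (le_trans (ler_normB _ _)) //.
have := psum_wave_bounded a; have := psum_wave_bounded b; lra.
Qed.

Lemma wave_large p' t : p = (4 * p')%N -> (p' <= t %% p <= 3 * p')%N -> 3 / 4 <= `|wave t|.
Proof.
move=> pE /andP[h1 h2]; rewrite norm_wave ler_pdivlMr ?exprn_gt0 //.
(* With [r = t %% p], the product [(r - p') * (3 * p' - r) >= 0] says exactly that the arch is at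
   least 3/4 in its middle half. *)
have := mulr_ge0 (_ : 0 <= (t %% p)%:R - p'%:R :> R) (_ : 0 <= 3 * p'%:R - (t %% p)%:R :> R).
rewrite !subr_ge0 -natrM !ler_nat h1 h2 => /(_ isT isT).
have -> : p%:R = 4 * p'%:R :> R by rewrite pE natrM.
rewrite natrM expr2; lra.
Qed.

End parabolic_wave.

(** * Effect of the oscillation on the expectation *)

Section integration_facts.
Context d (T : measurableType d) (R : realType).
Local Open Scope ereal_scope.

(** A difference of extended reals is finite only if both terms are, so the integrals of the
    positive and negative parts are finite. *)
Lemma fin_num_integrable (mu : {measure set T -> \bar R}) (f : T -> \bar R) :
  measurable_fun setT f -> \int[mu]_x f x \is a fin_num -> mu.-integrable setT f.
Proof.
move=> mf; rewrite integralE fin_numB => /andP[fp fn].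
apply/integrableP; split=> //.
under eq_integral do rewrite -/((abse \o f) _) fune_abse.
rewrite ge0_integralD //; [|exact: measurable_funepos|exact: measurable_funeneg].
rewrite lte_add_pinfty // -ge0_fin_numE // integral_ge0 //.
Qed.

(** Integrability is not assumed: positive and negative parts are pushed forward separately. *)
Lemma integral_push d' (T' : measurableType d') (P : {measure set T -> \bar R}) (X : {mfun T >-> T'})
    (f : T' -> \bar R) : measurable_fun setT f ->
  \int[pushforward P X]_y f y = \int[P]_x f (X x).
Proof.
move=> mf; rewrite [LHS]integralE [RHS]integralE.
have push g : measurable_fun setT g -> (forall y, 0 <= g y) ->
    \int[pushforward P X]_y g y = \int[P]_x g (X x).
  by move=> mg g0; rewrite (ge0_integral_pushforward _ P measurableT mg (fun y _ => g0 y)).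
congr (_ - _).
- rewrite push //; last exact: measurable_funepos.
  by apply: eq_integral => x _; rewrite !funeposE.
- rewrite push //; last exact: measurable_funeneg.
  by apply: eq_integral => x _; rewrite !funenegE.
Qed.

End integration_facts.

Section iso_tuple.
Context {R : realType} (n : nat).
Local Notation RR := (measurableTypeR R).
Local Notation V := (n.-tuple RR).

Definition trow (z : V) : 'rV[R]_n := \row_(j < n) tnth z j.

Definition tiso (i : 'I_n) (z : V) : R := iso (trow z) 0 i.

Lemma coordn_trow z : coordn (trow z) = tcoord z.
Proof.
apply/funext => t; have [tn|nt] := ltnP t n.
  by rewrite (coordn_lt _ tn) mxE (tnth_nth 0).
by rewrite coordn_ge // /tcoord nth_default // size_tuple.
Qed.

Lemma measurable_tiso i : measurable_fun setT (tiso i : V -> RR).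
Proof.
apply: (measurability _ (RGenCInfty.measurableE R)) => _ [_ [c ->] <-].
rewrite setTI (_ : _ @^-1` _ = \bigcup_(j in [set j : 'I_n | (j <= i)%N])
   \bigcap_(b in [set b : 'I_n | (i <= b)%N])
    [set z : V | (b.+1 - j)%:R * c <= \sum_(j <= t < b.+1) tcoord z t]).
  apply: fin_bigcup_measurable; first exact: finite_finset.
  move=> j _; apply: fin_bigcap_measurable; first exact: finite_finset.
  by move=> b _; apply: measurable_le_set => //; exact: measurable_tsum.
apply/seteqP; split => z /=; rewrite in_itv /= andbT.
  by move/iso_geP => [j [ji h]]; exists j => // b /= ib; rewrite -coordn_trow; exact: h.
move=> [j /= ji h]; apply/iso_geP; exists j; split => // b ib.
by rewrite coordn_trow; exact: h.
Qed.

Lemma trow_tshift (v : 'I_n -> R) z : trow (tshift v z) = trow z + \row_j v j.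
Proof. by apply/rowP => j; rewrite !mxE tnth_mktuple. Qed.

(** The value at [i] moves by at most [B / 4] when no vertex lies within [K] of [i], and by at most
    [B] otherwise; a union bound estimates the exceptional event. *)
Lemma tiso_shift_integral (P : probability V R) (v : 'I_n -> R) (w : nat -> R) (i : 'I_n)
    (B : R) (K lo hi : nat) :
  (forall j : 'I_n, v j = w j) -> (forall j, `|v j| <= B) ->
  (0 < K)%N -> (lo + K <= i)%N -> (i + K <= hi)%N -> (hi <= n)%N ->
  (forall a b, (a <= b)%N -> `|\sum_(a <= t < b) w t| <= B * (K%:R / 4)) ->
  (\int[P]_z (tiso i z)%:E)%E \is a fin_num ->
  exists2 D : R, (\int[P]_z (tiso i (tshift v z))%:E = \int[P]_z (tiso i z)%:E + D%:E)%E &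
    `|D| <= B * (1 / 4 + \sum_(i.+1 - K <= k < i + K)
                fine (P [set z | vertex (tcoord z) lo hi k])).
Proof.
move=> vw vB K0 loi ihi hin wB fin.
have B0 : 0 <= B by exact: le_trans (vB i).
have mi := measurable_tiso i.
have mi' : measurable_fun setT (fun z => tiso i (tshift v z) : RR).
  by apply: measurableT_comp => //; exact: measurable_tshift.
pose h z := tiso i (tshift v z) - tiso i z.
have mh : measurable_fun setT (h : V -> RR) by exact: measurable_funB.
have hB z : `|h z| <= B.
  rewrite /h /tiso trow_tshift; apply: iso_shift_bound => j.
  by rewrite mxE.
have ih : P.-integrable setT (EFin \o h).
  apply: measurable_bounded_integrable => //; first
    exact: (le_lt_trans (probability_le1 P measurableT) (ltry 1)).
  exists B; split; first exact: num_real.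
  by move=> M BM z _; exact: le_trans (hB z) (ltW BM).
have ii : P.-integrable setT (EFin \o tiso i).
  by apply: fin_num_integrable => //; apply/measurable_EFinP.
exists (fine (\int[P]_z (h z)%:E)%E).
  rewrite fineK; last exact: (integrable_fin_num _ ih).
  rewrite -integralD //=; apply: eq_integral => z _.
  by rewrite -EFinD /h addrC subrK.
pose U k := [set z : V | vertex (tcoord z) lo hi k].
have mU k : measurable (U k) by exact: measurable_vertex.
pose bad : set V := \big[setU/set0]_(i.+1 - K <= k < i + K) U k.
have mbad : measurable bad by apply: bigsetU_measurable.
have hbad z : `|h z| <= B / 4 + B * \1_bad z.
  have [zb|zb] := boolP (z \in bad).
    by rewrite indicE zb mulr1 (le_trans (hB z)) // lerDr divr_ge0.
  rewrite indicE (negbTE zb) mulr0 addr0.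
  have -> : B / 4 = B * (K%:R / 4) / K%:R by field; rewrite pnatr_eq0 -lt0n.
  rewrite /h /tiso trow_tshift.
  apply: (iso_shift_bound_away K0 loi ihi hin) => [k ik ki vk|a b /andP[ab bn]].
    move/negP: zb; apply; rewrite inE /bad -bigcup_seq /=; exists k.
      by rewrite /= mem_index_iota ki andbT leq_subLR addnC.
    by rewrite /U /= -coordn_trow.
  rewrite (_ : \sum_(a <= t < b) _ = \sum_(a <= t < b) w t); first exact: wB.
  rewrite !big_nat; apply: eq_bigr => t /andP[_ tb].
  by rewrite (coordn_lt _ (leq_trans tb bn)) mxE vw.
rewrite -lee_fin -abse_EFin fineK; last exact: (integrable_fin_num _ ih).
apply: le_trans (le_abse_integral P measurableT _) _; first by apply/measurable_EFinP.
apply: (@le_trans _ _ (\int[P]_z (B / 4 + B * \1_bad z)%:E)%E).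
  apply: ge0_le_integral => //.
  - by apply/measurable_EFinP; apply: measurableT_comp.
  - apply/measurable_EFinP; apply: measurable_funD => //; apply: measurable_funM => //.
  - by move=> z _; rewrite lee_fin.
rewrite (eq_integral (fun z => (B / 4)%:E + B%:E * (\1_bad z)%:E)%E); last first.
  by move=> z _; rewrite EFinD (EFinM B).
rewrite ge0_integralD //; last 3 first.
- by move=> z _; rewrite lee_fin divr_ge0.
- by move=> z _; rewrite -EFinM lee_fin mulr_ge0.
- by apply: emeasurable_funM => //; apply/measurable_EFinP.
rewrite ge0_integralZl //; last by apply/measurable_EFinP.
rewrite integral_cst //= probability_setT mule1 integral_indic // setIT.
rewrite mulrDr mul1r EFinD leeD2l // EFinM lee_wpmul2l // -sumEFin.
apply: le_trans (measure_bigsetU_le _ _ _ mU) _.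
by rewrite le_eqVlt; apply/orP; left; apply/eqP/eq_bigr => k _; rewrite (fineK (fin_num_measure P _ (mU k))).
Qed.

End iso_tuple.

(** * Counting biased indices *)

Lemma count_interval (lo hi m : nat) :
  (\sum_(t < m) ((lo <= t) && (t < hi)) = minn hi m - lo)%N.
Proof.
elim: m => [|m IH]; first by rewrite big_ord0 minn0 sub0n.
by rewrite big_ord_recr /= IH; case: (leqP lo m); case: (ltnP m hi) => /=; lia.
Qed.

Section counting.
Context {R : realType}.

Lemma count_intervalR (lo hi m : nat) :
  \sum_(t < m) ((lo <= t) && (t < hi))%N%:R = (minn hi m - lo)%:R :> R.
Proof. by rewrite -count_interval natr_sum. Qed.

Lemma count_mod_interval (p' B : nat) :
  \sum_(t < B * (4 * p')) ((p' <= t %% (4 * p')) && (t %% (4 * p') < 3 * p'))%N%:R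
    = (B * (2 * p'))%:R :> R.
Proof.
set p := (4 * p')%N; pose A (t : nat) : R := ((p' <= t %% p) && (t %% p < 3 * p'))%N%:R.
rewrite -[LHS]/(psum A 0 (B * p)).
elim: B => [|B IH]; first by rewrite !mul0n /psum big_ord0.
rewrite !mulSn [(p + _)%N]addnC [(2 * p' + _)%N]addnC psumD IH natrD; congr (_ + _).
rewrite /psum add0n (eq_bigr (fun t : 'I_p => ((p' <= t) && (t < 3 * p'))%N%:R)); last first.
  by move=> t _; rewrite /A modnMDl modn_small.
rewrite count_intervalR; congr _%:R; rewrite /p; lia.
Qed.

(** The pointwise inequality is summed over the middle halves of the arches, [2 * p'] indices each.
    The loss is [K] indices at either end of the window, and each [Pk k], weighted by 4, enters for
    at most [2 * K] indices. *)
Lemma window_count (ind Pk : nat -> R) (p' B K : nat) (H : R) (m := (B * (4 * p'))%N) :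
  (forall t, 0 <= ind t) -> (forall k, 0 <= Pk k) -> (K <= m)%N ->
  (forall t, (t < m)%N -> (K <= t)%N -> (t + K <= m)%N ->
     (p' <= t %% (4 * p') < 3 * p')%N ->
     1 <= ind t + 4 * \sum_(t.+1 - K <= k < t + K) Pk k) ->
  \sum_(k < m) Pk k <= H ->
  (B * (2 * p'))%:R - (2 * K)%:R - 8 * K%:R * H <= \sum_(t < m) ind t.
Proof.
move=> ind0 Pk0 Km hind hH.
pose F t := \sum_(k < m) Pk k * ((t.+1 - K <= k) && (k < t + K))%N%:R.
have F0 t : 0 <= F t by apply: sumr_ge0 => k _; rewrite mulr_ge0.
have step (t : 'I_m) : ((p' <= t %% (4 * p')) && (t %% (4 * p') < 3 * p'))%N%:R <=
    ind t + ((0 <= t) && (t < K))%N%:R + ((m.+1 - K <= t) && (t < m))%N%:R + 4 * F t.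
  case: (boolP (_ && _)) => [tp|_]; last by rewrite !addr_ge0 // mulr_ge0.
  have [tK|Kt] := ltnP t K; first by rewrite /= -addrA -addrA addrCA lerDl !addr_ge0 // mulr_ge0.
  have [mK|tKm] := leqP (m.+1 - K) t.
    by rewrite ltn_ord /= addr0 addrAC lerDr addr_ge0 // mulr_ge0.
  rewrite /= !addr0; have tKm' : (t + K <= m)%N by lia.
  apply: le_trans (hind t (ltn_ord t) Kt tKm' tp) _.
  rewrite lerD2l ler_wpM2l // /F.
  rewrite (big_nat_widenl _ 0) // (big_nat_widen _ _ m) // big_mkord big_mkcond /=.
  by apply: ler_sum => k _; case: ifP; rewrite ?mulr1 ?mulr0.
have : \sum_(t < m) ((p' <= t %% (4 * p')) && (t %% (4 * p') < 3 * p'))%N%:R <=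
    \sum_(t < m) (ind t + ((0 <= t) && (t < K))%N%:R + ((m.+1 - K <= t) && (t < m))%N%:R + 4 * F t).
  by apply: ler_sum => t _; exact: step.
rewrite [leLHS]count_mod_interval !big_split /= -mulr_sumr.
rewrite [\sum_(t < m) (t < K)%N%:R](count_intervalR 0 K m) (count_intervalR _ m m) => hs.
have hF : \sum_(t < m) F t <= (2 * K)%:R * H.
  rewrite /F exchange_big /= mulrC.
  apply: (@le_trans _ _ (\sum_(k < m) Pk k * (2 * K)%:R)).
    apply: ler_sum => k _; rewrite -mulr_sumr ler_wpM2l //.
    rewrite (eq_bigr (fun t : 'I_m => ((k.+1 - K <= t) && (t < k + K))%N%:R)); last first.
      by move=> t _; congr (nat_of_bool _)%:R; apply/idP/idP; lia.
    by rewrite count_intervalR ler_nat; lia.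
  by rewrite -mulr_suml ler_wpM2r.
have c1 : (minn K m - 0)%:R <= K%:R :> R by rewrite ler_nat; lia.
have c2 : (minn m m - (m.+1 - K))%:R <= K%:R :> R by rewrite ler_nat; lia.
rewrite (natrM _ 2 K) in hF *; move: hF hs c1 c2.
set x1 : R := (minn K m - 0)%:R; set x2 : R := (minn m m - _)%:R.
by move: x1 x2 (\sum_(t < m) F t) (\sum_(i < m) ind i) => x1 x2 x3 x4; lra.
Qed.

Lemma windows_count (ind : nat -> R) (m n : nat) (c : R) : (0 < m)%N -> (m <= n)%N ->
  0 <= c -> (forall t, 0 <= ind t) ->
  (forall w, (m %| w)%N -> (w + m <= n)%N -> m%:R * c <= psum ind w m) ->
  n%:R / 2 * c <= psum ind 0 n.
Proof.
move=> m0 mn c0 ind0 hw.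
pose q := (n %/ m)%N.
have qmn : (q * m <= n)%N by exact: leq_trunc_div.
have h q' : (q' <= q)%N -> (q' * m)%:R * c <= psum ind 0 (q' * m).
  elim: q' => [|q' IH] qq; first by rewrite mul0n mul0r /psum big_ord0.
  rewrite mulSn addnC natrD mulrDl psumD lerD ?IH ?(ltnW qq) // add0n hw ?dvdn_mull //.
  by rewrite addnC -mulSn (leq_trans _ qmn) // leq_mul2r qq orbT.
rewrite -(subnKC qmn) psumD.
apply: (@le_trans _ _ ((q * m)%:R * c)).
  (* At least one full window fits, so the full windows cover at least half of the [n] indices. *)
  rewrite subnKC // ler_wpM2r // ler_pdivrMr // -natrM ler_nat.
  have := ltn_pmod n m0; have := divn_eq n m; have : (0 < q)%N by rewrite divn_gt0.
  rewrite -/q; move: m0 mn; nia.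
by rewrite ler_wpDr ?h // sumr_ge0.
Qed.

End counting.

(** * From rare vertices to many biased indices *)

Section biased_indices.
Context {R : realType} (n p' B : nat) (a v : 'I_n -> R) (V H : R).
Local Notation RR := (measurableTypeR R).
Variable P : probability (n.-tuple RR) R.
Local Notation p := (4 * p')%N.
Local Notation m := (B * p)%N.
Hypotheses (p'0 : (0 < p')%N) (mn : (m <= n)%N) (V0 : 0 < V) (H0 : 0 <= H).
Hypothesis BH : 128 + 512 * H <= B%:R.
Hypothesis vE : forall i, v i = V * wave p i.
Hypothesis hH : forall w, (w + m <= n)%N ->
  \sum_(k < m) fine (P [set z | vertex (tcoord z) w (w + m) (w + k)]) <= H.
Variables S0 S1 : {set 'I_n}.
(* A non-finite expectation makes the bias infinite, so hS0 also provides the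
   integrability of [tiso i]. *)
Hypothesis hS0 : forall i, i \notin S0 ->
  (`|\int[P]_z (tiso i z)%:E - (a i)%:E| < (V / 8)%:E)%E.
Hypothesis hS1 : forall i, i \notin S1 ->
  (`|\int[P]_z (tiso i (tshift v z))%:E - (a i + v i)%:E| < (V / 8)%:E)%E.

Let p0 : (0 < p)%N. Proof. by rewrite muln_gt0. Qed.

Let B0 : (128 <= B)%N.
Proof. by rewrite -(ler_nat R); move: BH H0; lra. Qed.

Let m0 : (0 < m)%N.
Proof. by rewrite muln_gt0 p0 (leq_trans _ B0). Qed.

(** Sums of the oscillation are at most [4 * p * V = V * K / 4], which is what a shift of at most
    [V / 4] away from vertices requires. *)
Let K := (16 * p)%N.

(** Two biases below [V / 8] and [|v i| >= 3 / 4 * V] force the expectation to move by at least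
    [V / 2]. Only [V / 4] of this can come from samples without a vertex near [i]. *)
Lemma unbiased_near_vertex (i : 'I_n) w : (w + m <= n)%N -> (w + K <= i)%N -> (i + K <= w + m)%N ->
  3 / 4 <= `|wave p i : R| -> i \notin S0 -> i \notin S1 ->
  1 <= 4 * \sum_(i.+1 - K <= k < i + K) fine (P [set z | vertex (tcoord z) w (w + m) k]).
Proof.
move=> wmn wKi iKw wave_i /hS0 h0 /hS1 h1.
have fin0 : (\int[P]_z (tiso i z)%:E)%E \is a fin_num.
  by move: h0; case: (\int[P]_z _)%E => [r||].
have vB j : `|v j| <= V.
  by rewrite vE normrM (gtr0_norm V0) ler_piMr ?wave_le1 // ltW.
have wB x y : (x <= y)%N -> `|\sum_(x <= t < y) V * wave p t| <= V * (K%:R / 4).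
  move=> xy; rewrite -mulr_sumr normrM (gtr0_norm V0) ler_wpM2l ?(ltW V0) //.
  apply: le_trans (sum_wave_bounded p0 xy) _.
  by rewrite /K natrM; lra.
have K0 : (0 < K)%N by rewrite muln_gt0.
have [D DE hD] := tiso_shift_integral vE vB K0 wKi iKw wmn wB fin0.
move: h0 h1; rewrite {}DE -(fineK fin0) -EFinD -!EFinB !abse_EFin !lte_fin.
set x := fine _ => h0 h1.
have hv : 3 / 4 * V <= `|v i|.
  by rewrite vE normrM (gtr0_norm V0) mulrC ler_wpM2l ?(ltW V0).
set S := \sum_(_ <= _ < _) _ in hD *.
have : `|v i| <= `|D| + V / 8 + V / 8.
  have -> : v i = D + (x - a i) - (x + D - (a i + v i)) by ring.
  apply: le_trans (ler_normB _ _) _; apply: lerD; last exact: ltW.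
  by apply: le_trans (ler_normD _ _) _; rewrite lerD2l ltW.
move=> h2; have : V * (1 / 4) <= V * S by move: h2 hv hD; lra.
by rewrite ler_pM2l //; lra.
Qed.

Lemma biased_count : n%:R / 8 <= #|S0|%:R + #|S1|%:R :> R.
Proof.
pose ind (t : nat) : R := oapp (fun i : 'I_n => (i \in S0)%:R + (i \in S1)%:R) 0 (insub t).
have ind0 t : 0 <= ind t by rewrite /ind; case: insubP => //= i _ _; rewrite addr_ge0.
have indE (i : 'I_n) : ind i = (i \in S0)%:R + (i \in S1)%:R by rewrite /ind valK.
have cardE (S : {set 'I_n}) : \sum_(i < n) (i \in S)%:R = #|S|%:R :> R.
  by rewrite -natr_sum -sum1_card [in RHS]big_mkcond /=; congr _%:R; apply: eq_bigr => i _; case: (i \in S).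
have -> : #|S0|%:R + #|S1|%:R = psum ind 0 n.
  by rewrite -!cardE -big_split /psum; apply: eq_bigr => i _; rewrite add0n indE.
(* A quarter of each window is counted, and the windows cover half of the indices. *)
rewrite (_ : n%:R / 8 = n%:R / 2 * (1 / 4)); last by field.
apply: (windows_count m0 mn) => // w mw wmn.
pose Pk k := fine (P [set z | vertex (tcoord z) w (w + m) (w + k)]).
have Pk0 k : 0 <= Pk k by apply: fine_ge0.
have Km : (K <= m)%N by rewrite /K leq_mul2r (leq_trans _ B0) ?orbT.
have := window_count (ind := fun t => ind (w + t)%N) (H := H) (fun t => ind0 _) Pk0 Km.
(* Windows start at multiples of [p], so the oscillation has the same phase in each of them. *)
have pw : (p %| w)%N by rewrite (dvdn_trans _ mw) // dvdn_mull.
have modw t : ((w + t) %% p = t %% p)%N by case/dvdnP: pw => q ->; rewrite modnMDl.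
move=> /(_ _ (hH wmn)).
have step t : (t < m)%N -> (K <= t)%N -> (t + K <= m)%N -> (p' <= t %% p < 3 * p')%N ->
    1 <= ind (w + t)%N + 4 * \sum_(t.+1 - K <= k < t + K) Pk k.
  move=> tm Kt tKm tp.
  have wtn : (w + t < n)%N by rewrite (leq_trans _ wmn) // ltn_add2l.
  have S0' : 0 <= \sum_(t.+1 - K <= k < t + K) Pk k by apply: sumr_ge0.
  rewrite -[(w + t)%N]/(nat_of_ord (Ordinal wtn)) indE.
  case: (boolP (Ordinal wtn \in S0)) => [_|n0].
    by rewrite -addrA lerDl addr_ge0 // mulr_ge0.
  case: (boolP (Ordinal wtn \in S1)) => [_|n1].
    by rewrite add0r lerDl mulr_ge0.
  rewrite !add0r.
  have := @unbiased_near_vertex (Ordinal wtn) w wmn; rewrite /= leq_add2l Kt -addnA leq_add2l tKm.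
  move=> /(_ isT isT); rewrite -addnS.
  have -> : (w + t.+1 - K = (t.+1 - K) + w)%N by rewrite addnC addnBAC // ltnW.
  rewrite big_addn addKn.
  under eq_bigr do rewrite [(_ + w)%N]addnC.
  apply => //; apply: (wave_large p0 (erefl _)); rewrite modw.
  by case/andP: tp => -> /ltnW.
move=> /(_ step); apply: le_trans.
have p'R : 0 < p'%:R :> R by rewrite ltr0n.
(* As [K = 64 * p'], the count is at least [p' * (2 * B - 128 - 512 * H)], and [BH] makes this at
   least [p' * B = m / 4]. *)
have := ler_wpM2r (ltW p'R) BH; rewrite /K !natrM; lra.
Qed.

End biased_indices.

(** * Choice of the signal *)

Section law_of_sample.
Context {d : measure_display} {T : measurableType d} {R : realType} {n : nat}.
Local Notation RR := (measurableTypeR R).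
Variables (P : probability T R) (Y : 'I_n -> {RV P >-> R}).

Definition sample (w : T) : n.-tuple RR := [tuple Y j w | j < n].

Lemma measurable_sample : measurable_fun setT sample.
Proof.
apply/measurable_fun_tnthP => i /=.
rewrite (_ : _ \o _ = (Y i : T -> RR)); first exact: (measurable_funPT (Y i)).
by apply/funext => w /=; rewrite tnth_mktuple.
Qed.

HB.instance Definition _ := isMeasurableFun.Build _ _ _ _ sample measurable_sample.

Lemma normal_law_sample (mu : 'rV[R]_n) (v : R) : isotropic_normal Y mu v ->
  normal_law (Num.sqrt v) (fun i => mu 0 i) (distribution P sample).
Proof.
move=> [ind mar] A mA; rewrite /= /distribution /pushforward.
have -> : sample @^-1` tbox A = \bigcap_(i in [set` [set: 'I_n]%SET]) (Y i @^-1` A i).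
  apply/seteqP; split => w /= h i; last by rewrite tnth_mktuple; apply: h; rewrite /= finset.in_setT.
  by move=> _; have := h i; rewrite tnth_mktuple.
rewrite (ind [set: 'I_n]%SET A mA); apply: eq_big => [i|i _]; first by rewrite finset.in_setT.
exact: (mar i (A i) (mA i)).
Qed.

Lemma expectation_sample (i : 'I_n) :
  ('E_P[(fun w => iso (\row_(j < n) Y j w) 0 i)%R] =
   \int[distribution P sample]_z (tiso i z)%:E)%E.
Proof.
rewrite unlock; apply: esym.
apply: (etrans (integral_push P sample _)).
  by apply/measurable_EFinP; exact: measurable_tiso.
apply: eq_integral => w _; rewrite /tiso; congr (iso _ 0 i)%:E.
by apply/rowP => j; rewrite !mxE tnth_mktuple.
Qed.

End law_of_sample.

(** The oscillation has slope at most [4 * V / p <= 4 * c / n], which fits between [L0] and [L1];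
    its interpolation error is at most [8 * V * ((k - i) / p) ^ beta], which fits under [M / 4]. The
    case [V = 0] covers the line itself. *)
Lemma perturbed_line_conditions {R : realType} (L0 L1 M beta V c : R) (n p : nat) (mu : 'I_n -> R) :
  0 < L0 -> L0 < L1 -> 0 < M -> 1 <= beta -> beta <= 2 ->
  (0 < p)%N -> (p <= n)%N -> 0 <= c -> 8 * c <= L1 - L0 -> 32 * c <= M ->
  0 <= V -> V <= c * (p%:R / n%:R) `^ beta ->
  (forall i : 'I_n, mu i = (L0 + L1) / 2 * (i%:R / n%:R) + V * wave p i) ->
  [/\ (forall i j : 'I_n, (i <= j)%N -> `|mu j - mu i| <= L1 * ((j - i)%N%:R / n%:R)),
      (forall i j : 'I_n, (i <= j)%N -> mu j - mu i >= L0 * ((j - i)%N%:R / n%:R)) &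
      (forall i j k : 'I_n, (i <= j)%N -> (j <= k)%N -> (i < k)%N ->
             `|mu j - ((k - j)%N%:R / (k - i)%N%:R * mu i
                         + (j - i)%N%:R / (k - i)%N%:R * mu k)|
               <= M / 4 * ((k - i)%N%:R / n%:R) `^ beta)].
Proof.
move=> L00 L01 M0 b1 b2 p0 pn c0 cL cM V0 Vle muE.
have n0 : 0 < n%:R :> R by rewrite ltr0n (leq_trans p0).
have pR : 0 < p%:R :> R by rewrite ltr0n.
have pn0 : 0 < p%:R / n%:R :> R by rewrite divr_gt0.
have pn1 : p%:R / n%:R <= 1 :> R by rewrite ler_pdivrMr // mul1r ler_nat.
have Vpn : V <= c * (p%:R / n%:R).
  apply: le_trans Vle _; rewrite ler_wpM2l //.
  by rewrite -{2}[p%:R / n%:R](powRr1 (ltW pn0)) ger_powR // pn0.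
have diff (i j : 'I_n) : (i <= j)%N ->
    `|mu j - mu i - (L0 + L1) / 2 * ((j - i)%N%:R / n%:R)| <= (L1 - L0) / 2 * ((j - i)%N%:R / n%:R).
  move=> ij; rewrite !muE natrB //.
  have -> : (L0 + L1) / 2 * (j%:R / n%:R) + V * wave p j - ((L0 + L1) / 2 * (i%:R / n%:R) + V * wave p i)
      - (L0 + L1) / 2 * ((j%:R - i%:R) / n%:R) = V * (wave p j - wave p i) by field; rewrite gt_eqF.
  rewrite normrM (ger0_norm V0).
  apply: (le_trans (ler_wpM2l V0 (wave_dist p0 ij))); rewrite natrB //.
  have h : V * (4 / p%:R) <= (L1 - L0) / 2 / n%:R.
    have p4 : 0 <= 4 / p%:R :> R by rewrite divr_ge0 // ltW.
    apply: (le_trans (ler_wpM2r p4 Vpn)).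
    have -> : c * (p%:R / n%:R) * (4 / p%:R) = 4 * c / n%:R by field; rewrite !gt_eqF.
    by rewrite ler_pM2r ?invr_gt0 //; lra.
  have d0 : 0 <= j%:R - i%:R :> R by rewrite subr_ge0 ler_nat.
  rewrite mulrA; apply: (le_trans (ler_wpM2r d0 h)).
  by rewrite mulrAC mulrA.
split.
- move=> i j ij; have := diff i j ij; set x := _ / n%:R => h.
  have x0 : 0 <= x by rewrite divr_ge0 // ltW.
  have Lx : 0 <= L0 * x by rewrite mulr_ge0 // ltW.
  by move: h; rewrite !ler_norml => /andP[h1 h2]; apply/andP; split; lra.
- move=> i j ij; have := diff i j ij; set x := _ / n%:R => h.
  by move: h; rewrite ler_norml => /andP[h1 h2]; lra.
move=> i j k ij jk ik; rewrite !muE.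
have ki0 : 0 < (k - i)%:R :> R by rewrite ltr0n subn_gt0.
set X := _ - _.
have -> : X = V * (wave p j - ((k - j)%:R / (k - i)%:R * wave p i + (j - i)%:R / (k - i)%:R * wave p k)).
  rewrite /X !natrB ?(ltnW ik) //; rewrite natrB ?(ltnW ik) // in ki0.
  by field; rewrite !gt_eqF.
set E := _ - (_ + _).
have E1 : `|E| <= 8 * ((k - i)%:R / p%:R) ^+ 2.
  apply: (le_trans (interpolation_error _ (wave_increment2_le p0) ij jk ik)).
    by rewrite divr_ge0 // sqr_ge0.
  by rewrite le_eqVlt; apply/orP; left; apply/eqP; field; rewrite gt_eqF.
have E2 : `|E| <= 2.
  apply: le_trans (ler_normB _ _) _; have w1 := @wave_le1 R p p0.
  have : `|(k - j)%:R / (k - i)%:R * wave p i + (j - i)%:R / (k - i)%:R * wave p k| <= 1 :> R.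
    have r12 : (k - j)%:R / (k - i)%:R + (j - i)%:R / (k - i)%:R = 1 :> R.
      by rewrite -mulrDl -natrD addnBA // subnK // divff // gt_eqF.
    rewrite -[leRHS]r12; apply: le_trans (ler_normD _ _) _; apply: lerD.
      by rewrite (normrM _ (wave p i)) ger0_norm ?divr_ge0 // ler_piMr ?divr_ge0.
    by rewrite (normrM _ (wave p k)) ger0_norm ?divr_ge0 // ler_piMr ?divr_ge0.
  have := w1 j; lra.
have E3 : `|E| <= 8 * ((k - i)%:R / p%:R) `^ beta.
  (* Short ranges use the quadratic bound and [beta <= 2]; long ones use the bound 2, the power then
     being at least 1. *)
  have [h|h] := leP ((k - i)%:R / p%:R) (1 : R).
    apply: le_trans E1 _; rewrite ler_wpM2l // -powR_mulrn ?divr_ge0 //.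
    by rewrite ger_powR // divr_gt0.
  apply: le_trans E2 _.
  have : ((k - i)%:R / p%:R) `^ 0 <= ((k - i)%:R / p%:R) `^ beta :> R.
    by rewrite ler_powR ?(ltW h) // (le_trans ler01).
  by rewrite powRr0; lra.
rewrite normrM (ger0_norm V0).
have -> : (k - i)%:R / n%:R = (p%:R / n%:R) * ((k - i)%:R / p%:R) :> R by field; rewrite !gt_eqF.
rewrite powRM ?divr_ge0 //; set u := _ `^ beta in Vle *; set t := _ `^ beta in E3 *.
have u0 : 0 <= u by exact: powR_ge0.
have t0 : 0 <= t by exact: powR_ge0.
apply: (le_trans (ler_pM V0 (normr_ge0 _) Vle E3)).
have := mulr_ge0 (mulr_ge0 u0 t0) (_ : 0 <= M - 32 * c); rewrite subr_ge0 cM => /(_ isT).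
lra.
Qed.

Lemma expR1_le4 {R : realType} : expR 1 <= 4 :> R.
Proof.
have h : expR (- (1 / 2)) >= 1 / 2 :> R by have := @expR_ge1Dx R (- (1 / 2)); lra.
have e : expR 1 * expR (- (1 / 2)) ^+ 2 = 1 :> R.
  by rewrite -expRM_natl -expRD (_ : 1 + _ = 0) ?expR0 //; lra.
have h2 : 1 / 4 <= expR (- (1 / 2)) ^+ 2 :> R.
  have -> : 1 / 4 = (1 / 2) ^+ 2 :> R by field.
  by rewrite lerXn2r // nnegrE // expR_ge0.
have := ler_wpM2l (expR_ge0 (1 : R)) h2; rewrite e; lra.
Qed.

(** Bounding [ln (l / 8)] by [l / 8 - 1] and [ln 8] by 7 gives [5 * ln l <= 5 * l / 8 + 30], which
    is at most [l] from 80 on. *)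
Lemma ln_le_fifth {R : realType} (l : R) : 80 <= l -> 5 * ln l <= l.
Proof.
move=> l80.
have l8 : 0 < l / 8 by lra.
have h1 : ln (l / 8) <= l / 8 - 1.
  have h : -1 < l / 8 - 1 by lra.
  by have := le_ln1Dx h; rewrite [1 + _]addrC subrK.
have h2 : ln 8 <= 7 :> R.
  have h : -1 < 7 :> R by lra.
  by have := le_ln1Dx h; rewrite (_ : 1 + 7 = 8) //; ring.
have -> : ln l = ln (l / 8) + ln 8.
  by rewrite -lnM ?posrE // divfK.
lra.
Qed.

(* With l = ln n, a window of length m = B p satisfies m^3 / n^2 = O(l^-2), so that
   recentring a linear trend on it costs a factor e up to an error 1/n, while
   B >= 5000 l makes each constancy block long compared with the half period p. *)
Lemma window_parameters {R : realType} (L v : R) : 0 <= L -> 0 < v ->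
  exists2 C : R, 0 < C & forall n : nat, C <= n%:R -> exists p' B : nat, exists H : R,
  [/\ [/\ (0 < p')%N, (B * (4 * p') <= n)%N, (0 < B)%N, 0 <= H & 128 + 512 * H <= B%:R],
      forall (P : probability (n.-tuple (measurableTypeR R)) R) (w : nat),
        normal_law (Num.sqrt v) (fun i : 'I_n => L * (i%:R / n%:R)) P ->
        (w + B * (4 * p') <= n)%N ->
        \sum_(k < B * (4 * p')) fine (P [set z | vertex (tcoord z) w (w + B * (4 * p')) (w + k)]) <= H
    & forall beta : R, 0 <= beta ->
        n%:R `^ (- (beta / 3)) * ln n%:R `^ (- (5 * beta / 3)) <= ((4 * p')%N%:R / n%:R) `^ beta].
Proof.
move=> L0 v0.
(* With [H = 4 * (2 + l)], [128 + 512 * H = 4224 + 2048 * l], which is at most [2100 * l] once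
   [l >= 100]. *)
have [b b0 bE] : exists2 b : R, 0 < b & 30 * 70 <= b by exists (30 * 70) => //; lra.
pose C0 : R := (4 * (b + 1)) ^+ 3.
have C00 : 0 < C0 by rewrite exprn_gt0 // mulr_gt0 // addr_gt0.
pose l0 : R := 100 + 2 * L ^+ 2 * C0 / v.
have l0_ge : 0 <= 2 * L ^+ 2 * C0 / v.
  by apply: divr_ge0; rewrite ?(ltW v0) //; apply: mulr_ge0; rewrite ?(ltW C00) // mulr_ge0 // sqr_ge0.
(* The term [expR l0] makes [ln n >= l0]; the term [C0] makes the window fit into the sample. *)
exists (expR l0 + C0) => [|n hn]; first by rewrite addr_gt0 ?expR_gt0.
set x : R := n%:R in hn *.
have xl0 : expR l0 <= x by apply: le_trans hn; rewrite lerDl ltW.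
have xC0 : C0 <= x by apply: le_trans hn; rewrite lerDr expR_ge0.
have x0 : 0 < x by apply: lt_le_trans xC0.
set l := ln x.
have xE : x = expR l by rewrite lnK.
have ll0 : l0 <= l by rewrite -ler_expR -xE.
have l100 : 100 <= l by move: ll0 l0_ge; rewrite /l0; lra.
have lp : 0 < l by lra.
have ln5 : 5 * ln l <= l by apply: ln_le_fifth; lra.
(* This is [n^(2/3) (ln n)^(-5/3)], chosen so that [y ^+ 3 * l ^+ 5 = n ^+ 2]; [p'] is its integer
   part and [B] is of order [l]. *)
pose y := expR ((2 * l - 5 * ln l) / 3).
have y0 : 0 < y by exact: expR_gt0.
have y1 : 1 <= y by have := expR_ge1Dx ((2 * l - 5 * ln l) / 3); rewrite -/y; lra.
have y3 : y ^+ 3 * l ^+ 5 = x ^+ 2.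
  have -> : l ^+ 5 = expR (5 * ln l) by rewrite expRM_natl lnK.
  have -> : x ^+ 2 = expR (2 * l) by rewrite expRM_natl -xE.
  by rewrite /y -expRM_natl -expRD; congr expR; field.
have [p' p'0 /andP[p'y yp']] : exists2 p' : nat, (0 < p')%N & (p'%:R <= y) && (y < p'.+1%:R).
  by exists (Num.truncn y); rewrite ?truncn_gt0 // truncn_le (ltW y0) truncnS_gt.
have [B B0 /andP[lB Bl]] : exists2 B : nat, (0 < B)%N & (b * l <= B%:R) && (B%:R <= (b + 1) * l).
  exists (Num.truncn (b * l)).+1 => //; rewrite (ltW (truncnS_gt _)) /= -natr1.
  have h : (Num.truncn (b * l))%:R <= b * l by rewrite truncn_le mulr_ge0 // ltW.
  lra.
set m := (B * (4 * p'))%N.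
have mE : m%:R <= 4 * (b + 1) * (l * y).
  rewrite /m !natrM; have := ler_pM (ler0n R B) (ler0n R p') Bl p'y; lra.
have m3 : m%:R ^+ 3 * l ^+ 2 <= C0 * x ^+ 2.
  apply: (@le_trans _ _ ((4 * (b + 1) * (l * y)) ^+ 3 * l ^+ 2)).
    rewrite ler_wpM2r ?sqr_ge0 // lerXn2r // nnegrE // mulr_ge0 ?mulr_ge0 ?addr_ge0 // ltW //.
  rewrite le_eqVlt; apply/orP; left; apply/eqP.
  by rewrite -y3 /C0; ring.
have l2 : 1 <= l ^+ 2 by rewrite expr_ge1 //; lra.
have mx : m%:R <= x.
  have h : m%:R ^+ 3 <= x ^+ 3.
    apply: (@le_trans _ _ (m%:R ^+ 3 * l ^+ 2)); first by rewrite ler_peMr // exprn_ge0.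
    by apply: (le_trans m3); rewrite exprS ler_wpM2r // sqr_ge0.
  by move: h; rewrite ler_pXn2r // nnegrE // ltW.
have mn : (m <= n)%N by rewrite -(ler_nat R).
have m0 : (0 < m)%N by rewrite /m !muln_gt0 p'0 B0.
(* The vertex bound is [e * (1 + ln m)] plus an error at most [e]; then [e <= 4] and [ln m <= l]. *)
exists p', B, (4 * (2 + l)); split.
- split => //; first lra.
  by have := ler_wpM2r (ltW lp) bE; move: lB; lra.
- move=> P w hP wmn.
  have s0 : 0 < Num.sqrt v by rewrite sqrtr_gt0.
  have q1 : 1 <= 2 * l by lra.
  (* The line is recentred at its value at the left end of the window; [q = 2 * l] turns the error
     into [m * e / n]. *)
  have := window_vertices s0 (c := L * (w%:R / x)) (q := 2 * l) m0 wmn hP q1.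
  have hq (i : 'I_n) : (w <= i < w + m)%N ->
     2 * l * (m%:R * (L * (i%:R / n%:R) - L * (w%:R / x)) ^+ 2) <= Num.sqrt v ^+ 2.
    move=> /andP[wi iw]; rewrite sqr_sqrtr ?(ltW v0) // -/x.
    have iwm : (i%:R - w%:R) ^+ 2 <= m%:R ^+ 2 :> R.
      by rewrite -natrB // lerXn2r ?nnegrE // ler_nat leq_subLR ltnW.
    have -> : 2 * l * (m%:R * (L * (i%:R / x) - L * (w%:R / x)) ^+ 2) =
      2 * L ^+ 2 * (l * m%:R * (i%:R - w%:R) ^+ 2) / x ^+ 2 by field; rewrite gt_eqF.
    rewrite ler_pdivrMr ?exprn_gt0 //.
    have h1 : l * m%:R * (i%:R - w%:R) ^+ 2 <= l * m%:R ^+ 3.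
      by rewrite [m%:R ^+ 3]exprS mulrA ler_wpM2l ?mulr_ge0 ?(ltW lp).
    have L2 : 0 <= 2 * L ^+ 2 by rewrite mulr_ge0 // sqr_ge0.
    apply: (le_trans (ler_wpM2l L2 h1)).
    rewrite -(ler_pM2l lp).
    have h3 := ler_wpM2l L2 m3.
    have h4 : 2 * L ^+ 2 * C0 <= v * l.
      by rewrite -ler_pdivrMl // mulrC; move: ll0; rewrite /l0; lra.
    have h5 := ler_wpM2r (sqr_ge0 x) h4.
    by move: h3 h5; rewrite -[x ^+ 2]/(x * x); lra.
  move=> /(_ hq) h; rewrite -lee_fin -sumEFin.
  rewrite (eq_bigr (fun k : 'I_m => P [set z | vertex (tcoord z) w (w + m) (w + k)])); last first.
    by move=> k _; rewrite fineK // fin_num_measure //; exact: measurable_vertex.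
  apply: (le_trans h); rewrite lee_fin.
  have e4 := @expR1_le4 R.
  have lnm : ln m%:R <= l by rewrite ler_ln ?posrE // ltr0n.
  have lnm0 : 0 <= ln (m%:R : R) by rewrite ln_ge0 // ler1n.
  have -> : 1 - 2 * l / 2 = 1 - l by field.
  have : m%:R * expR (1 - l) <= expR 1.
    by rewrite expRD expRN -xE mulrCA ler_piMr ?expR_ge0 // ler_pdivrMr // mul1r.
  have := ler_wpM2r (_ : 0 <= 2 + ln m%:R) e4; rewrite addr_ge0 // => /(_ isT); lra.
move=> beta beta0.
have ypx : y / x <= (4 * p')%N%:R / x.
  rewrite ler_pM2r ?invr_gt0 // natrM; move: yp'; rewrite -natr1.
  have : 1 <= p'%:R :> R by rewrite ler1n.
  lra.
apply: (@le_trans _ _ ((y / x) `^ beta)); last first.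
  by rewrite ge0_ler_powR // nnegrE ?divr_ge0 // ltW.
have yx0 : 0 < y / x by rewrite divr_gt0.
rewrite /powR !gt_eqF // -expRD -/l ler_expR lnM ?posrE ?invr_gt0 // lnV ?posrE // -/l /y expRK.
lra.
Qed.

Theorem theorem2 (R : realType) (L0 L1 M beta sigma2 : R)
    (hL0 : 0 < L0) (hL01 : L0 < L1) (hM : 0 < M)
    (hbeta1 : 1 <= beta) (hbeta2 : beta <= 2) (hsigma2 : 0 < sigma2) :
  exists C C' C'' : R,
    [/\ 0 < C, 0 < C', 0 < C'' &
    forall n : nat, C <= n%:R ->
    exists mu : 'rV[R]_n,
      [/\ (forall i j : 'I_n, (i <= j)%N ->
             `|mu 0 j - mu 0 i| <= L1 * ((j - i)%N%:R / n%:R)),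
          (forall i j : 'I_n, (i <= j)%N ->
             mu 0 j - mu 0 i >= L0 * ((j - i)%N%:R / n%:R)),
          (forall i j k : 'I_n, (i <= j)%N -> (j <= k)%N -> (i < k)%N ->
             `|mu 0 j - ((k - j)%N%:R / (k - i)%N%:R * mu 0 i
                         + (j - i)%N%:R / (k - i)%N%:R * mu 0 k)|
               <= M / 4 * ((k - i)%N%:R / n%:R) `^ beta) &
          forall (d : measure_display) (T : measurableType d)
                 (P : probability T R) (Y : 'I_n -> {RV P >-> R}),
            isotropic_normal Y mu sigma2 ->
            C'' * n%:R <=
              #|[set i : 'I_n |
                  ((C' * n%:R `^ (- (beta / 3))
                       * ln n%:R `^ (- (5 * beta / 3)))%:E <=
                   `|'E_P[(fun w => iso (\row_(j < n) Y j w) 0 i)%R]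
                     - (mu 0 i)%:E|)%E]%SET|%:R]].
Proof.
pose L := (L0 + L1) / 2.
have L_ge0 : 0 <= L by rewrite /L; lra.
pose c : R := Num.min (M / 32) ((L1 - L0) / 8).
have c0 : 0 < c by rewrite lt_min !divr_gt0 // subr_gt0.
have cM : 32 * c <= M.
  have : c <= M / 32 by rewrite ge_min lexx.
  lra.
have cL : 8 * c <= L1 - L0.
  have : c <= (L1 - L0) / 8 by rewrite ge_min lexx orbT.
  lra.
have beta0 : 0 <= beta by lra.
have [C C_gt0 hC] := window_parameters L_ge0 hsigma2.
(* The factor [c / 8] puts the threshold below [V / 8]; two sets with at least [n / 8] elements in
   total cannot both have fewer than [n / 16]. *)
exists C, (c / 8), (16^-1); split => //; first by rewrite divr_gt0.
move=> n /hC[p' [B [H [[p'0 mn B0 H0 BH] hH hpow]]]].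
set p := (4 * p')%N in hH mn.
have p0 : (0 < p)%N by rewrite muln_gt0.
have pn : (p <= n)%N by apply: leq_trans mn; rewrite leq_pmull.
pose V : R := c * (p%:R / n%:R) `^ beta.
have pn0 : 0 < p%:R / n%:R :> R by rewrite divr_gt0 // ltr0n // (leq_trans p0).
have V0 : 0 < V by rewrite mulr_gt0 // powR_gt0.
set delta := c / 8 * _ * _.
have deltaV : delta <= V / 8.
  have := ler_wpM2l (ltW c0) (hpow beta beta0); rewrite -/p /delta /V; lra.
pose v (i : 'I_n) : R := V * wave p i.
pose mu0 : 'rV[R]_n := \row_i (L * (i%:R / n%:R)).
pose mu1 : 'rV[R]_n := \row_i (L * (i%:R / n%:R) + v i).
have muE0 (i : 'I_n) : mu0 0 i = L * (i%:R / n%:R) + 0 * wave p i by rewrite mxE mul0r addr0.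
have muE1 (i : 'I_n) : mu1 0 i = L * (i%:R / n%:R) + V * wave p i by rewrite mxE.
pose biased (mu : 'rV[R]_n) (E : 'I_n -> \bar R) : {set 'I_n} :=
  [set i : 'I_n | (delta%:E <= `|E i - (mu 0 i)%:E|)%E]%SET.
pose good mu := forall (d : measure_display) (T : measurableType d)
    (P : probability T R) (Y : 'I_n -> {RV P >-> R}), isotropic_normal Y mu sigma2 ->
  16^-1 * n%:R <= #|biased mu (fun i => 'E_P[(fun w => iso (\row_(j < n) Y j w) 0 i)%R])%E|%:R :> R.
(* The line is chosen if it works for every sample with its law; otherwise the oscillating signal
   is, and a sample violating the claim for it would make the line good. *)
have [good0|bad0] := pselect (good mu0).
  exists mu0.
  have [] := perturbed_line_conditions hL0 hL01 hM hbeta1 hbeta2 p0 pn (ltW c0) cL cM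
    (lexx 0) (ltW V0) muE0.
  by split.
exists mu1.
have [] := perturbed_line_conditions hL0 hL01 hM hbeta1 hbeta2 p0 pn (ltW c0) cL cM
    (ltW V0) (lexx V) muE1.
split => // d T P Y hY; rewrite leNgt; apply/negP => bad1.
apply: bad0 => d0 T0 P0 Y0 hY0; rewrite leNgt; apply/negP => bad0.
have law0 : normal_law (Num.sqrt sigma2) (fun i : 'I_n => L * (i%:R / n%:R))
    (distribution P0 (sample Y0)).
  have := normal_law_sample hY0.
  by rewrite (_ : (fun i => mu0 0 i) = fun i : 'I_n => L * (i%:R / n%:R)) //; apply/funext => i; rewrite mxE.
have law1 : normal_law (Num.sqrt sigma2) (fun i : 'I_n => L * (i%:R / n%:R) + v i)
    (distribution P (sample Y)).
  have := normal_law_sample hY.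
  by rewrite (_ : (fun i => mu1 0 i) = fun i : 'I_n => L * (i%:R / n%:R) + v i) //; apply/funext => i; rewrite mxE.
have s0 : 0 < Num.sqrt sigma2 by rewrite sqrtr_gt0.
(* The two samples may live on different spaces; adding [v] to the first gives the law of the
   second, so both biases are read off one law. *)
have law01 := normal_law_tshift s0 v law0.
have small mu E i : i \notin biased mu E -> (`|E i - (mu 0 i)%:E| < (V / 8)%:E)%E.
  by rewrite inE -ltNge => /lt_le_trans; apply; rewrite lee_fin.
have hS0 i : i \notin biased mu0 (fun i => 'E_P0[(fun w => iso (\row_(j < n) Y0 j w) 0 i)%R])%E ->
    (`|\int[distribution P0 (sample Y0)]_z (tiso i z)%:E - (L * (i%:R / n%:R))%:E| < (V / 8)%:E)%E.
  by move=> /small; rewrite expectation_sample mxE.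
have hS1 i : i \notin biased mu1 (fun i => 'E_P[(fun w => iso (\row_(j < n) Y j w) 0 i)%R])%E ->
    (`|\int[distribution P0 (sample Y0)]_z (tiso i (tshift v z))%:E -
       (L * (i%:R / n%:R) + v i)%:E| < (V / 8)%:E)%E.
  move=> /small; rewrite expectation_sample mxE.
  rewrite (integral_law_unique (fun z => (tiso i z)%:E) law1 law01) integral_push //.
  by apply/measurable_EFinP; exact: measurable_tiso.
have := biased_count p'0 mn V0 H0 BH (fun i => erefl)
  (fun w => hH (distribution P0 (sample Y0)) w law0) hS0 hS1.
by move: bad0 bad1; lra.
Qed.
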